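(* Let $u$ be a nonconstant inner function, and let $\varphi\in L^\infty(\mathbb{T})$ be unimodular ($|\varphi|=1$ a.e. on $\mathbb{T}$). The minimum modulus of the dual truncated Toeplitz operator $D_\varphi$ on $\mathcal{K}_u^\perp$ is given by \[ m(D_\varphi)=\sqrt{1-\|B_{\overline{\varphi}}\|^2}=\sqrt{1-\sup_{f\in\mathcal{K}_u,\ \|f\|=1}\left(\|T_{\overline{u\varphi}}f\|^2+\|H_{\overline{\varphi}}f\|^2\right)}. \] Furthermore, \[ \sqrt{\max\left(0,\ 1-\left(\|T_{\overline{u\varphi}}|_{\mathcal{K}_u}\|^2+\|H_{\overline{\varphi}}|_{\mathcal{K}_u}\|^2\right)\right)}\le m(D_\varphi)\le\min\left(\sqrt{1-\|T_{\overline{u\varphi}}|_{\mathcal{K}_u}\|^2},\ \sqrt{1-\|H_{\overline{\varphi}}|_{\mathcal{K}_u}\|^2}\right). \]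
   Context: $L^2=L^2(\mathbb{T})$ with normalized Lebesgue measure on the unit circle $\mathbb{T}$; $H^2\subset L^2$ is the Hardy space, $P$ the orthogonal projection of $L^2$ onto $H^2$, $P_-=I-P$, $H^2_-=P_-(L^2)$. An inner function is a bounded analytic function $u$ on the unit disc with $|u|=1$ a.e. on $\mathbb{T}$. The model space is $\mathcal{K}_u=H^2\ominus uH^2$, with orthogonal projection $P_{\mathcal{K}_u}$ of $L^2$ onto it; its orthogonal complement in $L^2$ is $\mathcal{K}_u^\perp=uH^2\oplus H^2_-$ and $P_{\mathcal{K}_u^\perp}=I-P_{\mathcal{K}_u}$. For $\psi\in L^\infty(\mathbb{T})$: the Toeplitz operator $T_\psi:H^2\to H^2$ is $T_\psi f=P(\psi f)$; the Hankel operator $H_\psi:H^2\to H^2_-$ is $H_\psi f=P_-(\psi f)$; $D_\psi:\mathcal{K}_u^\perp\to\mathcal{K}_u^\perp$ is $D_\psi f=P_{\mathcal{K}_u^\perp}(\psi f)$; and $B_\psi:\mathcal{K}_u\to\mathcal{K}_u^\perp$ is $B_\psi f=P_{\mathcal{K}_u^\perp}(\psi f)$. The minimum modulus is $m(T)=\inf\{\|Tx\|:\|x\|=1\}$. *)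

(* Defs.v *)
From mathcomp Require Import all_boot all_order all_algebra.
From mathcomp Require Import all_classical all_reals all_analysis.
From mathcomp Require Import complex.

Set Implicit Arguments.
Unset Strict Implicit.
Unset Printing Implicit Defensive.

Import Order.TTheory GRing.Theory Num.Theory.
Import numFieldNormedType.Exports.

Local Open Scope classical_set_scope.
Local Open Scope ring_scope.
Local Open Scope complex_scope.

(* A function on the unit circle is represented by a function of the angle
   theta in [0, 2 * pi], and an element of L^p by any of its representatives.
   Values outside [0, 2 * pi] are irrelevant: [circle_prob] does not charge
   the complement of that interval. *)

Lemma circle_prob_subproof (R : realType) : (0 : R) < 2 * pi.
Proof. by rewrite mulr_gt0 ?pi_gt0. Qed.

Definition circle_prob (R : realType) : probability (measurableTypeR R) R :=
  uniform_prob (circle_prob_subproof R).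

Definition expi {R : realType} (t : R) : R[i] := cos t +i* sin t.

Definition cmeasurable {R : realType} (f : R -> R[i]) : Prop :=
  measurable_fun [set: R] (fun t => complex.Re (f t)) /\
  measurable_fun [set: R] (fun t => complex.Im (f t)).

Definition cintegral {R : realType} (f : R -> R[i]) : R[i] :=
  Rintegral (circle_prob R) [set: R] (fun t => complex.Re (f t)) +i*
  Rintegral (circle_prob R) [set: R] (fun t => complex.Im (f t)).

Definition L2 {R : realType} : set (R -> R[i]) :=
  [set f | cmeasurable f /\
    (\int[circle_prob R]_t ((Normc.normc (f t)) ^+ 2)%:E < +oo)%E].

Definition Linfty {R : realType} : set (R -> R[i]) :=
  [set f | cmeasurable f /\
    exists M : R, {ae circle_prob R, forall t, Normc.normc (f t) <= M}].

Definition inner {R : realType} (f g : R -> R[i]) : R[i] :=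
  cintegral (fun t => f t * (g t)^*).

Definition norm2 {R : realType} (f : R -> R[i]) : R :=
  Num.sqrt (Rintegral (circle_prob R) [set: R]
    (fun t => (Normc.normc (f t)) ^+ 2)).

Definition fourier {R : realType} (f : R -> R[i]) (n : int) : R[i] :=
  cintegral (fun t => f t * (expi (n%:~R * t))^*).

Definition H2 {R : realType} : set (R -> R[i]) :=
  [set f | L2 f /\ forall n : int, n < 0 -> fourier f n = 0].

(* The orthogonal projection of f onto a closed subspace M of L^2, i.e. the
   element g of M, unique up to a.e. equality, with f - g orthogonal to M. *)
Definition orthoproj {R : realType} (M : set (R -> R[i])) (f : R -> R[i]) :
    R -> R[i] :=
  xget (fun=> 0) [set g | M g /\ forall h, M h -> inner (f \- g) h = 0].

Definition orthocompl {R : realType} (M : set (R -> R[i])) : set (R -> R[i]) :=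
  [set f | L2 f /\ forall g, M g -> inner f g = 0].

Definition unimodular {R : realType} (f : R -> R[i]) : Prop :=
  {ae circle_prob R, forall t, `|f t| = 1}.

(* The norm topology on R[i] and complex differentiability come from its
   structure of normed module over itself, carried by the copy R[i]^o. *)
Definition analytic_disc {R : realType} (u : R[i] -> R[i]) : Prop :=
  forall z : R[i], `|z| < 1 -> derivable (u : R[i]^o -> R[i]^o) z 1.

Definition bounded_disc {R : realType} (u : R[i] -> R[i]) : Prop :=
  exists M : R, forall z : R[i], `|z| < 1 -> Normc.normc (u z) <= M.

Definition radial {R : realType} (u : R[i] -> R[i]) (t r : R) : R[i]^o :=
  u (r%:C * expi t).

Definition boundary {R : realType} (u : R[i] -> R[i]) (t : R) : R[i] :=
  lim (radial u t r @[r --> (1 : R)^'-]).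

(* The a.e. existence of the radial limits is stated because [lim] is total;
   it is automatic for bounded analytic functions (Fatou). *)
Definition inner_function {R : realType} (u : R[i] -> R[i]) : Prop :=
  [/\ analytic_disc u, bounded_disc u,
      {ae circle_prob R, forall t, cvg (radial u t r @[r --> (1 : R)^'-])} &
      unimodular (boundary u)].

Definition nonconstant_disc {R : realType} (u : R[i] -> R[i]) : Prop :=
  exists z w : R[i], [/\ `|z| < 1, `|w| < 1 & u z != u w].

Definition model_space {R : realType} (u : R[i] -> R[i]) : set (R -> R[i]) :=
  [set f | H2 f /\ forall h, H2 h -> inner f (boundary u \* h) = 0].

Definition toeplitz {R : realType} (psi f : R -> R[i]) : R -> R[i] :=
  orthoproj H2 (psi \* f).

Definition hankel {R : realType} (psi f : R -> R[i]) : R -> R[i] :=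
  (psi \* f) \- orthoproj H2 (psi \* f).

(* The following two operators are given by the same formula; the first one
   acts on the orthogonal complement of the model space, the second one on the
   model space. The domain is an argument of [opnorm] and [min_modulus]. *)
Definition dualTTO {R : realType} (u : R[i] -> R[i]) (psi f : R -> R[i]) :
    R -> R[i] :=
  (psi \* f) \- orthoproj (model_space u) (psi \* f).

Definition Bop {R : realType} (u : R[i] -> R[i]) (psi f : R -> R[i]) :
    R -> R[i] :=
  (psi \* f) \- orthoproj (model_space u) (psi \* f).

Definition opnorm {R : realType} (M : set (R -> R[i]))
    (T : (R -> R[i]) -> (R -> R[i])) : R :=
  sup [set norm2 (T f) | f in [set f | M f /\ norm2 f <= 1]].

Definition min_modulus {R : realType} (M : set (R -> R[i]))
    (T : (R -> R[i]) -> (R -> R[i])) : R :=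
  inf [set norm2 (T f) | f in [set f | M f /\ norm2 f = 1]].

Definition conjf {R : realType} (f : R -> R[i]) : R -> R[i] :=
  fun t => (f t)^*.

(* Main.v *)
(* Multiplication by phi is unitary, so on the orthogonal complement of K the
   identity |D f|^2 = |f|^2 - |P_K (phi f)|^2 holds, where f |-> P_K (phi f) is
   the adjoint of B = B_(conj phi); hence inf |D f|^2 over unit f is 1 - |B|^2. For inner u
   one has P_K w = P w - u P (conj u w), so that
   |w - P_K w|^2 = |w - P w|^2 + |P (conj u w)|^2, and w = conj phi f turns
   |B f|^2 into |T f|^2 + |H f|^2; the bounds follow by comparing suprema.

   What has to be proved about u is that its boundary function multiplies H^2
   into itself. In the coordinate z = exp (s + i t), Goursat's argument makes
   the coefficients of u (e^s e^(it)) independent of s up to the factor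
   e^(n s), so those of negative index vanish; Chernoff's argument writes
   u (e^s e^(it)) as the limit of its Fourier series, and letting s tend to 0
   gives the claim by dominated convergence. *)

Require Import Defs.
From mathcomp Require Import all_boot all_order all_algebra.
From mathcomp Require Import all_classical all_reals all_analysis measurable_realfun.
From mathcomp Require Import complex ring lra.

Import Order.TTheory GRing.Theory Num.Theory.
Import numFieldNormedType.Exports.

Local Open Scope classical_set_scope.
Local Open Scope ring_scope.
Local Open Scope complex_scope.

Set Implicit Arguments.
Unset Strict Implicit.
Unset Printing Implicit Defensive.

Local Open Scope ring_scope.

(** * Complex-valued measurable and integrable functions *)

Section ComplexMeasurable.
Context {R : realType}.
Implicit Types (f g : R -> R[i]) (z w : R[i]).

(** Elements of L^2 are bare functions here, so uniqueness of projections, linearity of P_K and the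
    identification of [boundary u] with a measurable function hold only up to null sets. The algebra
    is therefore done for representatives [b] and [a] that are measurable and unimodular at every
    point; only quantities blind to null sets, namely norms and inner products, are carried back to
    [boundary u] and [phi]. The logarithmic coordinate turns circles into vertical segments, so
    Cauchy's theorem on rectangles is enough, and it pushes the origin to -infinity, where the
    boundedness of u forces the coefficients to 0. Coefficients alone would determine u on a circle
    only through a completeness theorem; Chernoff's argument gets the pointwise expansion from
    Bessel's inequality alone. Comparing two circles makes the coefficients decay geometrically, so
    the partial sums are uniformly bounded, as dominated convergence demands. *)

Lemma normc_sqr z : Normc.normc z ^+ 2 = complex.Re z ^+ 2 + complex.Im z ^+ 2.
Proof. by case: z => a b /=; rewrite sqr_sqrtr// addr_ge0// sqr_ge0. Qed.

Lemma normc_ge0 z : 0 <= Normc.normc z.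
Proof. by case: z => a b /=; rewrite sqrtr_ge0. Qed.

Lemma normc_norm z : `|z| = (Normc.normc z)%:C.
Proof. by case: z. Qed.

Lemma norm_Re_le z : `|complex.Re z| <= Normc.normc z.
Proof.
rewrite -sqrtr_sqr -[leRHS]ger0_norm ?normc_ge0// -[leRHS]sqrtr_sqr.
by rewrite ler_wsqrtr// normc_sqr lerDl sqr_ge0.
Qed.

Lemma norm_Im_le z : `|complex.Im z| <= Normc.normc z.
Proof.
rewrite -sqrtr_sqr -[leRHS]ger0_norm ?normc_ge0// -[leRHS]sqrtr_sqr.
by rewrite ler_wsqrtr// normc_sqr lerDr sqr_ge0.
Qed.

Lemma normc_conj z : Normc.normc z^* = Normc.normc z.
Proof. by case: z => a b /=; rewrite sqrrN. Qed.

Lemma normc_real (a : R) : Normc.normc a%:C = `|a|.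
Proof. by rewrite /= expr0n addr0 sqrtr_sqr. Qed.

Lemma normc_le_ReIm z : Normc.normc z <= `|complex.Re z| + `|complex.Im z|.
Proof.
rewrite -[leLHS]ger0_norm ?normc_ge0// -[leRHS]ger0_norm ?addr_ge0//.
rewrite -[leLHS]sqrtr_sqr -[leRHS]sqrtr_sqr ler_wsqrtr// normc_sqr sqrrD.
by rewrite !real_normK ?num_real// lerD2r lerDl mulrn_wge0// mulr_ge0.
Qed.

Lemma cReD z w : complex.Re (z + w) = complex.Re z + complex.Re w.
Proof. by case: z w => [a b] [c d]. Qed.
Lemma cImD z w : complex.Im (z + w) = complex.Im z + complex.Im w.
Proof. by case: z w => [a b] [c d]. Qed.
Lemma cReB z w : complex.Re (z - w) = complex.Re z - complex.Re w.
Proof. by case: z w => [a b] [c d]. Qed.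
Lemma cImB z w : complex.Im (z - w) = complex.Im z - complex.Im w.
Proof. by case: z w => [a b] [c d]. Qed.
Lemma cReM z w : complex.Re (z * w) =
  complex.Re z * complex.Re w - complex.Im z * complex.Im w.
Proof. by case: z w => [a b] [c d]. Qed.
Lemma cImM z w : complex.Im (z * w) =
  complex.Re z * complex.Im w + complex.Im z * complex.Re w.
Proof. by case: z w => [a b] [c d]. Qed.
Lemma conjE z : (z^*)%C = z^*.
Proof. by []. Qed.
Lemma cReJ z : complex.Re z^* = complex.Re z.
Proof. by case: z. Qed.
Lemma cImJ z : complex.Im z^* = - complex.Im z.
Proof. by case: z. Qed.
Lemma conjC_real (a : R) : a%:C^* = a%:C.
Proof. by rewrite -conjE /= oppr0. Qed.
Lemma conjC1 : (1 : R[i])^* = 1.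
Proof. exact: (conjC_real 1). Qed.
Lemma cReC (a : R) : complex.Re a%:C = a.
Proof. by []. Qed.
Lemma Re_realM (a : R) z : complex.Re (a%:C * z) = a * complex.Re z.
Proof. by rewrite cReM /= mul0r subr0. Qed.
Lemma Im_realM (a : R) z : complex.Im (a%:C * z) = a * complex.Im z.
Proof. by rewrite cImM /= mul0r addr0. Qed.

Lemma complex_ext z w : complex.Re z = complex.Re w ->
  complex.Im z = complex.Im w -> z = w.
Proof. by case: z w => [a b] [c d] /= -> ->. Qed.

Lemma conjC_realM (a : R) z : (a%:C * z)^* = a%:C * z^*.
Proof.
by apply: complex_ext; rewrite ?Re_realM ?Im_realM ?cReJ ?cImJ ?Re_realM ?Im_realM ?mulrN.
Qed.

Lemma mulcJ z : z * z^* = (Normc.normc z ^+ 2)%:C.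
Proof.
apply: complex_ext; rewrite ?cReM ?cImM !cReJ cImJ ?normc_sqr /=.
  by rewrite mulrN opprK !expr2.
by rewrite mulrN mulrC addrC subrr.
Qed.

Lemma cmeasurableD f g : cmeasurable f -> cmeasurable g ->
  cmeasurable (fun t => f t + g t).
Proof.
move=> [f1 f2] [g1 g2]; split.
  by under eq_fun do rewrite cReD; exact: measurable_funD.
by under eq_fun do rewrite cImD; exact: measurable_funD.
Qed.

Lemma cmeasurableB f g : cmeasurable f -> cmeasurable g ->
  cmeasurable (fun t => f t - g t).
Proof.
move=> [f1 f2] [g1 g2]; split.
  by under eq_fun do rewrite cReB; exact: measurable_funB.
by under eq_fun do rewrite cImB; exact: measurable_funB.
Qed.

Lemma cmeasurableM f g : cmeasurable f -> cmeasurable g ->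
  cmeasurable (fun t => f t * g t).
Proof.
move=> [f1 f2] [g1 g2]; split.
  under eq_fun do rewrite cReM.
  by apply: measurable_funB; exact: measurable_funM.
under eq_fun do rewrite cImM.
by apply: measurable_funD; exact: measurable_funM.
Qed.

Lemma cmeasurable_conj f : cmeasurable f -> cmeasurable (fun t => (f t)^*).
Proof.
move=> [f1 f2]; split.
  by under eq_fun do rewrite cReJ.
by under eq_fun do rewrite cImJ; exact: measurable_funN.
Qed.

Lemma cmeasurable_cst z : cmeasurable (fun _ : R => z).
Proof. by split; exact: measurable_cst. Qed.

Lemma measurable_normc_sqr f : cmeasurable f ->
  measurable_fun [set: R] (fun t => Normc.normc (f t) ^+ 2).
Proof.
move=> [f1 f2]; under eq_fun do rewrite normc_sqr.
by apply: measurable_funD; exact: measurable_funX.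
Qed.

Lemma measurable_normc f : cmeasurable f ->
  measurable_fun [set: R] (fun t => Normc.normc (f t)).
Proof.
move=> mf.
rewrite (_ : (fun t => _) = (fun t => Num.sqrt (Normc.normc (f t) ^+ 2))).
  apply: (@measurableT_comp _ _ _ _ _ _ (@Num.sqrt R)).
    exact: (continuous_measurable_fun (@sqrt_continuous R)).
  exact: measurable_normc_sqr.
by apply/funext => t; rewrite sqrtr_sqr ger0_norm// normc_ge0.
Qed.

End ComplexMeasurable.

Arguments Normc.normc : simpl never.
Arguments inner : simpl never.
Arguments cintegral : simpl never.
Arguments norm2 : simpl never.
Arguments fourier : simpl never.

(** * Complex integrals and almost everywhere equality *)

Section ComplexIntegral.
Context {R : realType}.
Notation mu := (circle_prob R).
Implicit Types (f g h : R -> R[i]) (z : R[i]).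
Import HBNNSimple.

Definition rintegrable (f : R -> R) := mu.-integrable [set: R] (EFin \o f).

Definition cintegrable f :=
  rintegrable (fun t => complex.Re (f t)) /\
  rintegrable (fun t => complex.Im (f t)).

Lemma rintegrableD (f g : R -> R) : rintegrable f -> rintegrable g ->
  rintegrable (fun t => f t + g t).
Proof. by move=> /(integrableD measurableT) /[apply]. Qed.

Lemma rintegrableB (f g : R -> R) : rintegrable f -> rintegrable g ->
  rintegrable (fun t => f t - g t).
Proof. by move=> /(integrableB measurableT) /[apply]. Qed.

Lemma rintegrableZ (a : R) (f : R -> R) : rintegrable f ->
  rintegrable (fun t => a * f t).
Proof. by move=> /(integrableZl measurableT a). Qed.

Lemma rintegrable_le (f g : R -> R) : measurable_fun [set: R] f ->
  (forall t, `|f t| <= g t) -> rintegrable g -> rintegrable f.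
Proof.
move=> mf fg; apply: le_integrable => //; first exact/measurable_EFinP.
by move=> t _; rewrite lee_fin (le_trans (fg t))// ler_norm.
Qed.

Lemma rintegrable_cst (a : R) : rintegrable (fun=> a).
Proof. exact: finite_measure_integrable_cst. Qed.

Lemma rintegrable_measurable (f : R -> R) : rintegrable f ->
  measurable_fun [set: R] f.
Proof. by move=> /measurable_int /measurable_EFinP. Qed.

Lemma cintegrable_le f (g : R -> R) : cmeasurable f ->
  (forall t, Normc.normc (f t) <= g t) -> rintegrable g -> cintegrable f.
Proof.
move=> [f1 f2] fg ig; split; apply: rintegrable_le ig => // t.
  exact: le_trans (norm_Re_le _) (fg t).
exact: le_trans (norm_Im_le _) (fg t).
Qed.

Lemma cintegrable_normc f : cintegrable f ->
  rintegrable (fun t => Normc.normc (f t)).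
Proof.
move=> [f1 f2].
apply: (@rintegrable_le _ (fun t => `|complex.Re (f t)| + `|complex.Im (f t)|)).
- by apply: measurable_normc; split; exact: rintegrable_measurable.
- by move=> t; rewrite ger0_norm ?normc_ge0// normc_le_ReIm.
- by apply: rintegrableD; exact: integrable_norm.
Qed.

Lemma cintegrableD f g : cintegrable f -> cintegrable g ->
  cintegrable (fun t => f t + g t).
Proof.
move=> [f1 f2] [g1 g2]; split.
  by under eq_fun do rewrite cReD; exact: rintegrableD.
by under eq_fun do rewrite cImD; exact: rintegrableD.
Qed.

Lemma cintegrableZ z f : cintegrable f -> cintegrable (fun t => z * f t).
Proof.
move=> [f1 f2]; split.
  by under eq_fun do rewrite cReM; apply: rintegrableB; exact: rintegrableZ.
by under eq_fun do rewrite cImM; apply: rintegrableD; exact: rintegrableZ.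
Qed.

Lemma cintegralD f g : cintegrable f -> cintegrable g ->
  cintegral (fun t => f t + g t) = cintegral f + cintegral g.
Proof.
move=> [f1 f2] [g1 g2]; apply: complex_ext; rewrite ?cReD ?cImD /cintegral /=.
  by under eq_Rintegral do rewrite cReD; rewrite RintegralD.
by under eq_Rintegral do rewrite cImD; rewrite RintegralD.
Qed.

Lemma cintegralZ z f : cintegrable f ->
  cintegral (fun t => z * f t) = z * cintegral f.
Proof.
move=> [f1 f2]; apply: complex_ext; rewrite ?cReM ?cImM /cintegral /=.
  under eq_Rintegral do rewrite cReM.
  by rewrite RintegralB// ?RintegralZl//; exact: rintegrableZ.
under eq_Rintegral do rewrite cImM.
by rewrite RintegralD// ?RintegralZl//; exact: rintegrableZ.
Qed.

Lemma cintegral_conj f : cintegrable f ->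
  cintegral (fun t => (f t)^*) = (cintegral f)^*.
Proof.
move=> [f1 f2]; apply: complex_ext; rewrite ?cReJ ?cImJ /cintegral /=.
  by under eq_Rintegral do rewrite cReJ.
under eq_Rintegral do rewrite cImJ -mulN1r.
by rewrite RintegralZl// mulN1r.
Qed.

(** Real and imaginary parts are estimated separately, whence the factor 2. It is harmless: the
    bound only serves to show that coefficients vanish or decay. *)
Lemma normc_cintegral f : cintegrable f ->
  Normc.normc (cintegral f) <= 2 * Rintegral mu [set: R] (fun t => Normc.normc (f t)).
Proof.
move=> [f1 f2]; have fn := cintegrable_normc (conj f1 f2).
apply: (le_trans (normc_le_ReIm _)); rewrite mulr2n mulrDl mul1r /cintegral /=.
have lem (k : R -> R) : rintegrable k -> (forall t, `|k t| <= Normc.normc (f t)) ->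
    `|Rintegral mu [set: R] k| <= Rintegral mu [set: R] (fun t => Normc.normc (f t)).
  move=> ik kf; apply: (le_trans (le_normr_Rintegral measurableT ik)).
  by apply: le_Rintegral => //; exact: integrable_norm.
by apply: lerD; apply: lem => // t; [exact: norm_Re_le|exact: norm_Im_le].
Qed.

Lemma cintegral_cst z : cintegral (fun=> z) = z.
Proof.
apply: complex_ext; rewrite /cintegral /=; rewrite Rintegral_cst//.
all: by have /= -> := @probability_setT _ _ _ mu; rewrite mulr1.
Qed.

Lemma ae_mono (P Q : R -> Prop) : (forall t, P t -> Q t) ->
  {ae mu, forall t, P t} -> {ae mu, forall t, Q t}.
Proof.
by move=> PQ [N [mN N0 PN]]; exists N; split => // t /= Qt; apply: PN => /= /PQ.
Qed.

Lemma ae_mono2 (P Q S : R -> Prop) : (forall t, P t -> Q t -> S t) ->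
  {ae mu, forall t, P t} -> {ae mu, forall t, Q t} -> {ae mu, forall t, S t}.
Proof.
move=> PQS [N [mN N0 PN]] [M [mM M0 QM]]; exists (N `|` M); split.
- exact: measurableU.
- by rewrite measureU0.
move=> t /= St; have [Pt|/PN] := pselect (P t); last by left.
by right; apply: QM => /= Qt; apply: St; exact: PQS.
Qed.

(* No measurability is required: [boundary u] is only known to coincide
   almost everywhere with a measurable function. *)
Lemma ge0_ae_le_integral_nonmeas (f g : R -> \bar R) :
  (forall t, 0 <= f t)%E -> (forall t, 0 <= g t)%E ->
  {ae mu, forall t, f t = g t} ->
  (\int[mu]_t f t <= \int[mu]_t g t)%E.
Proof.
move=> f0 g0 [N [mN N0 fgN]].
rewrite !ge0_integralTE//; apply: ge_ereal_sup => _ [h hf <-].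
(* Cut to 0 on the null set [N], the simple function [h] lies below [g] everywhere and keeps its
   integral. *)
apply: ereal_sup_ubound; exists (proj_nnsfun h (measurableC mN)) => /=.
  move=> t; rewrite mindicE; have [tN|tN] := boolP (t \in ~` N).
    rewrite mulr1; have [fg|/fgN Nt] := pselect (f t = g t); first by rewrite -fg hf.
    by move: tN; rewrite inE => /(_ Nt).
  by rewrite mulr0.
rewrite -!integralT_nnsfun; apply: ge0_ae_eq_integral => //.
- by apply/measurable_EFinP; exact: measurable_funPT.
- by apply/measurable_EFinP; exact: measurable_funPT.
- by move=> t _; rewrite lee_fin.
- by move=> t _; rewrite lee_fin.
exists N; split => // t /= /not_implyP[_]; apply: contra_notP => Nt.
by rewrite mindicE mem_set ?mulr1.
Qed.

Lemma ae_eq_integral_nonmeas (f g : R -> \bar R) :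
  {ae mu, forall t, f t = g t} -> (\int[mu]_t f t = \int[mu]_t g t)%E.
Proof.
have sym (f1 g1 : R -> \bar R) : {ae mu, forall t, f1 t = g1 t} ->
  {ae mu, forall t, g1 t = f1 t} by apply: ae_mono => t ->.
have ge0 (f1 g1 : R -> \bar R) : (forall t, 0 <= f1 t)%E ->
    (forall t, 0 <= g1 t)%E -> {ae mu, forall t, f1 t = g1 t} ->
    (\int[mu]_t f1 t = \int[mu]_t g1 t)%E.
  move=> f0 g0 fg; apply/eqP; rewrite eq_le.
  by rewrite !ge0_ae_le_integral_nonmeas//; exact: sym.
move=> fg; rewrite integralE [RHS]integralE.
by congr (_ - _)%E; apply: ge0 => //; apply: ae_mono fg => t fgt;
  rewrite ?funeposE ?funenegE fgt.
Qed.

Lemma ae_eq_cintegral f g : {ae mu, forall t, f t = g t} ->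
  cintegral f = cintegral g.
Proof.
move=> fg; rewrite /cintegral /Rintegral.
by congr (fine _ +i* fine _); apply: ae_eq_integral_nonmeas; apply: ae_mono fg => t ->.
Qed.

Lemma ae_eq_inner f1 f2 g1 g2 : {ae mu, forall t, f1 t = f2 t} ->
  {ae mu, forall t, g1 t = g2 t} -> inner f1 g1 = inner f2 g2.
Proof.
move=> f12 g12; apply: ae_eq_cintegral.
by apply: ae_mono2 f12 g12 => t -> ->.
Qed.

Lemma ae_eq_norm2 f g : {ae mu, forall t, f t = g t} -> norm2 f = norm2 g.
Proof.
move=> fg; congr (Num.sqrt (fine _)); apply: ae_eq_integral_nonmeas.
by apply: ae_mono fg => t ->.
Qed.

End ComplexIntegral.

(** * The inner product of L^2 *)

Section L2Space.
Context {R : realType}.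
Notation mu := (circle_prob R).
Implicit Types (f g h : R -> R[i]) (z : R[i]).

Lemma L2P f : L2 f <->
  cmeasurable f /\ rintegrable (fun t => Normc.normc (f t) ^+ 2).
Proof.
have nE : (\int[mu]_t `|(Normc.normc (f t) ^+ 2)%:E| =
    \int[mu]_t (Normc.normc (f t) ^+ 2)%:E)%E.
  by apply: eq_integral => t _; rewrite gee0_abs// lee_fin sqr_ge0.
split=> [[mf fi]|[mf /integrableP[_ fi]]]; split => //.
  apply/integrableP; split; last by rewrite /= nE.
  by apply/measurable_EFinP; exact: measurable_normc_sqr.
by move: fi; rewrite /= nE.
Qed.

Lemma L2_measurable f : L2 f -> cmeasurable f.
Proof. by case. Qed.

Lemma normc_sqrD z w : Normc.normc (z + w) ^+ 2 <=
  2 * Normc.normc z ^+ 2 + 2 * Normc.normc w ^+ 2.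
Proof.
have := le_normcD z w; have := normc_ge0 (z + w).
have := normc_ge0 z; have := normc_ge0 w.
set a := Normc.normc z; set b := Normc.normc w; set c := Normc.normc _.
move=> b0 a0 c0 cab; have : c ^+ 2 <= (a + b) ^+ 2.
  by rewrite lerXn2r ?nnegrE ?addr_ge0.
by have := sqr_ge0 (a - b); nra.
Qed.

Lemma L2_mul_bounded (M : R) p f : cmeasurable p ->
  (forall t, Normc.normc (p t) <= M) -> L2 f -> L2 (p \* f).
Proof.
move=> mp pM /L2P[mf fi]; apply/L2P.
have mpf : cmeasurable (p \* f) by exact: cmeasurableM.
split => //; apply: (@rintegrable_le _ _ (fun t => M ^+ 2 * Normc.normc (f t) ^+ 2)).
- exact: measurable_normc_sqr.
- move=> t; rewrite ger0_norm ?sqr_ge0//= Normc.normcM exprMn.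
  rewrite ler_wpM2r ?sqr_ge0// lerXn2r ?nnegrE ?normc_ge0//.
  exact: le_trans (normc_ge0 _) (pM t).
- exact: rintegrableZ.
Qed.

Lemma L2Z z f : L2 f -> L2 (z \*o f).
Proof.
exact: (@L2_mul_bounded (Normc.normc z) (fun=> z) f (cmeasurable_cst z)).
Qed.

Lemma L2D f g : L2 f -> L2 g -> L2 (f \+ g).
Proof.
move=> /L2P[mf fi] /L2P[mg gi]; apply/L2P.
have mfg : cmeasurable (f \+ g) by exact: cmeasurableD.
split => //; apply: (@rintegrable_le _ _ (fun t =>
  2 * Normc.normc (f t) ^+ 2 + 2 * Normc.normc (g t) ^+ 2)).
- exact: measurable_normc_sqr.
- by move=> t; rewrite ger0_norm ?sqr_ge0//= normc_sqrD.
- by apply: rintegrableD; exact: rintegrableZ.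
Qed.

Lemma subf_addZ f g : f \- g = f \+ ((-1) \*o g).
Proof. by apply/funext => t; rewrite /= mulN1r. Qed.

Lemma L2B f g : L2 f -> L2 g -> L2 (f \- g).
Proof. by move=> Lf Lg; rewrite subf_addZ; apply: L2D => //; exact: L2Z. Qed.

Lemma L2_bounded (M : R) f : cmeasurable f ->
  (forall t, Normc.normc (f t) <= M) -> L2 f.
Proof.
move=> mf fM; apply/L2P; split => //.
apply: (@rintegrable_le _ _ (fun=> M ^+ 2)).
- exact: measurable_normc_sqr.
- move=> t; rewrite ger0_norm ?sqr_ge0// lerXn2r ?nnegrE ?normc_ge0//.
  exact: le_trans (normc_ge0 _) (fM t).
- exact: rintegrable_cst.
Qed.

Lemma L2_cst z : L2 (fun=> z).
Proof. by apply: (@L2_bounded (Normc.normc z)) => //; exact: cmeasurable_cst. Qed.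

Lemma L2_cintegrableM f g : L2 f -> L2 g -> cintegrable (fun t => f t * (g t)^*).
Proof.
move=> /L2P[mf fi] /L2P[mg gi].
apply: (@cintegrable_le _ _ (fun t => Normc.normc (f t) ^+ 2 + Normc.normc (g t) ^+ 2)).
- by apply: cmeasurableM => //; exact: cmeasurable_conj.
- move=> t; rewrite Normc.normcM normc_conj.
  have := normc_ge0 (f t); have := normc_ge0 (g t).
  by set a := Normc.normc (f t); set b := Normc.normc _; nra.
- exact: rintegrableD.
Qed.

Lemma L2_cintegrable f : L2 f -> cintegrable f.
Proof.
move=> Lf; have := L2_cintegrableM Lf (L2_cst 1).
by under eq_fun do rewrite conjC1 mulr1.
Qed.

Lemma innerDl f g h : L2 f -> L2 g -> L2 h ->
  inner (f \+ g) h = inner f h + inner g h.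
Proof.
move=> Lf Lg Lh; rewrite /inner -cintegralD; try exact: L2_cintegrableM.
by congr cintegral; apply/funext => t; rewrite mulrDl.
Qed.

Lemma innerZl z f h : L2 f -> L2 h -> inner (z \*o f) h = z * inner f h.
Proof.
move=> Lf Lh; rewrite /inner -cintegralZ; last exact: L2_cintegrableM.
by congr cintegral; apply/funext => t; rewrite /= mulrA.
Qed.

Lemma inner_conj f g : L2 f -> L2 g -> inner g f = (inner f g)^*.
Proof.
move=> Lf Lg; rewrite /inner -cintegral_conj; last exact: L2_cintegrableM.
by congr cintegral; apply/funext => t; rewrite rmorphM /= conjCK mulrC.
Qed.

Lemma innerBl f g h : L2 f -> L2 g -> L2 h ->
  inner (f \- g) h = inner f h - inner g h.
Proof.
move=> Lf Lg Lh; rewrite subf_addZ innerDl ?innerZl ?mulN1r//.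
exact: L2Z.
Qed.

Lemma innerDr f g h : L2 f -> L2 g -> L2 h ->
  inner h (f \+ g) = inner h f + inner h g.
Proof.
by move=> Lf Lg Lh; rewrite (inner_conj (L2D Lf Lg) Lh) ?innerDl// rmorphD /= -!inner_conj.
Qed.

Lemma innerZr z f h : L2 f -> L2 h -> inner h (z \*o f) = z^* * inner h f.
Proof.
by move=> Lf Lh; rewrite (inner_conj (L2Z z Lf) Lh) innerZl// rmorphM /= -inner_conj.
Qed.

Lemma innerBr f g h : L2 f -> L2 g -> L2 h ->
  inner h (f \- g) = inner h f - inner h g.
Proof.
by move=> Lf Lg Lh; rewrite (inner_conj (L2B Lf Lg) Lh) innerBl// rmorphB /= -!inner_conj.
Qed.

Lemma norm2_ge0 f : 0 <= norm2 f.
Proof. exact: sqrtr_ge0. Qed.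

Lemma norm2_sqrE f :
  norm2 f ^+ 2 = Rintegral mu [set: R] (fun t => Normc.normc (f t) ^+ 2).
Proof. by rewrite sqr_sqrtr// Rintegral_ge0// => t _; rewrite sqr_ge0. Qed.

Lemma innerff f : inner f f = (norm2 f ^+ 2)%:C.
Proof.
rewrite norm2_sqrE /inner; under eq_fun do rewrite mulcJ.
by apply: complex_ext => //=; rewrite Rintegral_cst//= mul0r.
Qed.

Lemma norm2_sqr f : norm2 f ^+ 2 = complex.Re (inner f f).
Proof. by rewrite innerff. Qed.

Lemma norm2D_sqr f g : L2 f -> L2 g -> norm2 (f \+ g) ^+ 2 =
  norm2 f ^+ 2 + norm2 g ^+ 2 + 2 * complex.Re (inner f g).
Proof.
move=> Lf Lg; have Lfg := L2D Lf Lg; rewrite !norm2_sqr innerDl// !innerDr// !cReD.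
by rewrite (inner_conj Lf Lg) cReJ; ring.
Qed.

Lemma norm2Z z f : L2 f -> norm2 (z \*o f) = Normc.normc z * norm2 f.
Proof.
move=> Lf; apply/eqP; rewrite -(@eqrXn2 _ 2) ?norm2_ge0 ?mulr_ge0 ?normc_ge0//.
  rewrite exprMn norm2_sqr innerZl ?innerZr//; last exact: L2Z.
  by rewrite mulrA mulcJ Re_realM norm2_sqr.
exact: norm2_ge0.
Qed.

Lemma norm2B_sqr f g : L2 f -> L2 g -> norm2 (f \- g) ^+ 2 =
  norm2 f ^+ 2 + norm2 g ^+ 2 - 2 * complex.Re (inner f g).
Proof.
move=> Lf Lg; have Lg' := L2Z (-1) Lg.
rewrite subf_addZ norm2D_sqr// norm2Z// innerZr//.
rewrite -(rmorphN1 (real_complex R)) conjC_real Re_realM normc_real normrN1.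
by rewrite mul1r mulN1r mulrN.
Qed.

(** Cauchy-Schwarz, from the nonnegativity of |f - s g|^2 for every real s. *)
Lemma Re_inner_le f g : L2 f -> L2 g -> complex.Re (inner f g) <= norm2 f * norm2 g.
Proof.
move=> Lf Lg.
have key (s : R) : 0 <= norm2 f ^+ 2 + s ^+ 2 * norm2 g ^+ 2 -
    2 * (s * complex.Re (inner f g)).
  have := sqr_ge0 (norm2 (f \- (s%:C \*o g))).
  rewrite norm2B_sqr//; last exact: L2Z.
  by rewrite norm2Z// innerZr// conjC_real Re_realM normc_real exprMn real_normK ?num_real.
have f0 := norm2_ge0 f; have g0 := norm2_ge0 g.
set a := norm2 f in f0 key *; set b := norm2 g in g0 key *.
set c := complex.Re _ in key *.
have [b00|bpos] := eqVneq b 0.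
  rewrite b00 mulr0 leNgt; apply/negP => cpos.
  (* With [b = 0] the quadratic is affine in s, and this s would give it the value -1. *)
  have := key ((a ^+ 2 + 1) / (2 * c)); rewrite b00 expr0n mulr0 addr0.
  have : 2 * ((a ^+ 2 + 1) / (2 * c) * c) = a ^+ 2 + 1.
    by field; rewrite lt0r_neq0.
  by move=> ->; lra.
have bgt : 0 < b by rewrite lt_neqAle eq_sym bpos.
have := key (a / b).
have -> : a ^+ 2 + (a / b) ^+ 2 * b ^+ 2 - 2 * (a / b * c) = 2 * a / b * (a * b - c).
  by field.
have [a00|apos] := eqVneq a 0.
  (* For [a = 0] the choice s = a / b is void; s = c / b^2 is the minimiser of the quadratic. *)
  move=> _; have := key (c / b ^+ 2).
  have -> : a ^+ 2 + (c / b ^+ 2) ^+ 2 * b ^+ 2 - 2 * (c / b ^+ 2 * c) = - (c / b) ^+ 2.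
    by rewrite a00; field.
  rewrite oppr_ge0 => h; have /eqP : (c / b) ^+ 2 == 0 by rewrite eq_le h sqr_ge0.
  by move/eqP; rewrite sqrf_eq0 mulf_eq0 invr_eq0 (negPf bpos) orbF a00 mul0r => /eqP ->.
have agt : 0 < a by rewrite lt_neqAle eq_sym apos.
by rewrite pmulr_rge0 ?subr_ge0// divr_gt0// mulr_gt0.
Qed.

(** Replacing g by <f, g> g turns the inner product into the real number |<f, g>|^2, so the bound on
    real parts applies. *)
Lemma normc_inner_le f g : L2 f -> L2 g ->
  Normc.normc (inner f g) <= norm2 f * norm2 g.
Proof.
move=> Lf Lg; have Lg' := L2Z (inner f g) Lg.
have := Re_inner_le Lf Lg'.
rewrite innerZr// norm2Z// mulrC mulcJ cReC.
have [->|h] := eqVneq (Normc.normc (inner f g)) 0.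
  by move=> _; rewrite mulr_ge0 ?norm2_ge0.
have hp : 0 < Normc.normc (inner f g) by rewrite lt_neqAle eq_sym h normc_ge0.
by rewrite expr2 mulrCA ler_pM2l.
Qed.

(** A substitute for equality: two projections of one function are only known to be at distance 0,
    and this transfers their norms. *)
Lemma norm2_eq_of_sub0 f g : L2 f -> L2 g -> norm2 (f \- g) = 0 -> norm2 f = norm2 g.
Proof.
move=> Lf Lg fg0; have h := norm2B_sqr Lf Lg; rewrite fg0 expr0n in h.
have := Re_inner_le Lf Lg; move: h; have := norm2_ge0 f; have := norm2_ge0 g.
set a := norm2 f; set b := norm2 g; set c := complex.Re _ => b0 a0 h1 h2.
have : (a - b) ^+ 2 <= 0 by move: h1 h2 => /=; rewrite sqrrB; lra.
by rewrite -[_ <= 0]andbT -(sqr_ge0 (a - b)) -eq_le sqrf_eq0 subr_eq0 => /eqP.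
Qed.

Lemma pythagoras f g : L2 f -> L2 g -> inner f g = 0 ->
  norm2 (f \+ g) ^+ 2 = norm2 f ^+ 2 + norm2 g ^+ 2.
Proof. by move=> Lf Lg fg; rewrite norm2D_sqr// fg mulr0 addr0. Qed.

End L2Space.

(** * Completeness and orthogonal projections *)

Section RieszFischer.
Context {R : realType}.
Notation mu := (circle_prob R).

Lemma cvgn_EFin (u : nat -> R) (l : R) : u @ \oo --> l ->
  (fun n => (u n)%:E) @ \oo --> l%:E.
Proof. by move=> ul; apply: cvg_EFin => //; exact: nearW. Qed.

(** The inequality d <= d^2 / (2 r) + r / 2 turns the L^2 bound on an increment into an L^1 bound by
    [r n], the measure having mass 1. The sum of the increments is then integrable, hence finite
    almost everywhere, and the telescoping series converges absolutely. *)
Lemma ae_cvg_of_summable_increments (f : nat -> R -> R) (r : nat -> R) :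
  (forall n, measurable_fun [set: R] (f n)) -> (forall n, 0 < r n) ->
  (\sum_(n <oo) (r n)%:E < +oo)%E ->
  (forall n, \int[mu]_t ((f n.+1 t - f n t) ^+ 2)%:E <= (r n ^+ 2)%:E)%E ->
  {ae mu, forall t, cvgn (f ^~ t)}.
Proof.
move=> mf r0 rsum fr.
pose d n t := `|f n.+1 t - f n t|.
have md n : measurable_fun [set: R] (d n).
  by apply: measurableT_comp => //; exact: measurable_funB.
have amgm n t : d n t <= (r n)^-1 / 2 * (f n.+1 t - f n t) ^+ 2 + r n / 2.
  have rn := r0 n; rewrite /d -(real_normK (num_real (_ - _))).
  set x := `| _ |.
  have -> : (r n)^-1 / 2 * x ^+ 2 + r n / 2 =
      x + (x - r n) ^+ 2 * ((r n)^-1 / 2).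
    by field; rewrite lt0r_neq0.
  by rewrite lerDl mulr_ge0 ?sqr_ge0// divr_ge0// invr_ge0 ltW.
have id n : (\int[mu]_t (d n t)%:E <= (r n)%:E)%E.
  have rn := r0 n.
  have c0 : 0 <= (r n)^-1 / 2 by rewrite divr_ge0// invr_ge0 ltW.
  have msq : measurable_fun [set: R] (fun t => (f n.+1 t - f n t) ^+ 2).
    by apply: measurable_funX; exact: measurable_funB.
  apply: (@le_trans _ _ (\int[mu]_t
     (((r n)^-1 / 2)%:E * ((f n.+1 t - f n t) ^+ 2)%:E + (r n / 2)%:E))%E).
    apply: ge0_le_integral => //.
    - by move=> t _; rewrite lee_fin /d.
    - by apply/measurable_EFinP; exact: (md n).
    - apply/measurable_EFinP; apply: measurable_funD; last exact: measurable_cst.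
      by apply: measurable_funM; [exact: measurable_cst|exact: msq].
    - by move=> t _; rewrite -EFinM -EFinD lee_fin amgm.
  rewrite ge0_integralD//=; first last.
  - by move=> t _; rewrite lee_fin divr_ge0// ltW.
  - by apply/measurable_EFinP/measurable_funM; [exact: measurable_cst|exact: msq].
  - by move=> t _; rewrite -EFinM lee_fin mulr_ge0// sqr_ge0.
  rewrite ge0_integralZl//; first last.
  - by move=> t _; rewrite lee_fin sqr_ge0.
  - by apply/measurable_EFinP; exact: msq.
  have /= mu1 := @probability_setT _ _ _ mu.
  rewrite integral_cst//= mu1 mule1.
  apply: (@le_trans _ _ (((r n)^-1 / 2)%:E * (r n ^+ 2)%:E + (r n / 2)%:E)%E).
    by rewrite leeD2r// lee_wpmul2l// lee_fin.
  rewrite -EFinM -EFinD lee_fin le_eqVlt; apply/orP; left; apply/eqP.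
  by field; rewrite lt0r_neq0.
have isum : (\int[mu]_t (\sum_(n <oo) (d n t)%:E) < +oo)%E.
  rewrite integral_nneseries//; first last.
  - by move=> n t _; rewrite lee_fin /d.
  - by move=> n; apply/measurable_EFinP; exact: (md n).
  apply: le_lt_trans rsum; apply: lee_nneseries => n _ //.
  by move=> _; apply: integral_ge0 => t _; rewrite lee_fin /d.
have fin : {ae mu, forall t, [set: R] t ->
    (\sum_(n <oo) (d n t)%:E)%E \is a fin_num}.
  apply: integrable_ae => //; apply/integrableP; split.
    apply: (@ge0_emeasurable_sum _ _ _ _ (fun n t => (d n t)%:E) xpredT) => n.
      by move=> t _ _; rewrite lee_fin /d.
    by move=> _; apply/measurable_EFinP; exact: (md n).
  under eq_integral do (rewrite gee0_abs; last by
    apply: nneseries_ge0 => n _ _; rewrite lee_fin /d).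
  exact: isum.
apply: ae_mono fin => t /(_ I) dfin.
have cd : cvgn [normed series (telescope (f ^~ t))].
  apply: nondecreasing_is_cvgn.
    apply/nondecreasing_seqP => n; rewrite /= /series/= !big_mkord.
    by rewrite big_ord_recr lerDl.
  exists (fine (\sum_(n <oo) (d n t)%:E)%E) => _ [n _ <-].
  rewrite -lee_fin fineK// /series/= -sumEFin.
  apply: (@nneseries_lim_ge _ (fun n => (d n t)%:E) xpredT 0) => k _ _.
  by rewrite lee_fin /d.
have := normed_cvg cd; rewrite [X in cvgn X](_ : _ = (fun n => f n t - f 0 t)).
  move=> /cvg_ex[l fl]; apply/cvg_ex; exists (l + f 0 t).
  rewrite (_ : f ^~ t = (fun n => (f n t - f 0 t) + f 0 t)); last first.
    by apply/funext => n; rewrite subrK.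
  by apply: cvgD => //; exact: cvg_cst.
exact: telescopeK.
Qed.

Lemma riesz_fischer_fast (f : nat -> R -> R) (r : nat -> R) :
  (forall n, measurable_fun [set: R] (f n)) -> (forall n, 0 < r n) ->
  (\sum_(n <oo) (r n)%:E < +oo)%E ->
  (forall n m, (n <= m)%N ->
    \int[mu]_t ((f m t - f n t) ^+ 2)%:E <= (r n ^+ 2)%:E)%E ->
  exists2 g : R -> R, measurable_fun [set: R] g &
    forall n, (\int[mu]_t ((g t - f n t) ^+ 2)%:E <= (r n ^+ 2)%:E)%E.
Proof.
move=> mf r0 rsum fr.
(* The upper limit is measurable without any knowledge of the set of convergence; it is the limit
   almost everywhere. Fatou's lemma then gives the bounds. *)
pose g t := fine (limn_esup (fun n => (f n t)%:E)).
have mg : measurable_fun [set: R] g.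
  apply: (@measurableT_comp _ _ _ _ _ _ fine); first exact: fine_measurable.
  by apply: measurable_fun_limn_esup => n; exact/measurable_EFinP.
exists g => // n.
have fcvg := ae_cvg_of_summable_increments mf r0 rsum
  (fun n => fr n n.+1 (leqnSn n)).
pose h m t := ((f m t - f n t) ^+ 2)%:E.
have -> : (\int[mu]_t ((g t - f n t) ^+ 2)%:E =
    \int[mu]_t limn_einf (h ^~ t))%E.
  apply: ae_eq_integral_nonmeas; apply: ae_mono fcvg => t /cvg_ex[l fl].
  have -> : g t = l.
    by rewrite /g; have [_ ->] := cvg_limn_einf_sup (cvgn_EFin fl).
  have hl : h ^~ t @ \oo --> ((l - f n t) ^+ 2)%:E.
    apply: cvgn_EFin.
    by apply: (@cvgM _ _ _ _ (fun m => f m t - f n t) (fun m => f m t - f n t));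
      apply: cvgB => //; exact: cvg_cst.
  by have [-> _] := cvg_limn_einf_sup hl.
apply: (le_trans (fatou _ _ _ _)) => //.
- move=> m; apply/measurable_EFinP; apply: measurable_funX.
  exact: (measurable_funB (mf m) (mf n)).
- by move=> m t _; rewrite lee_fin sqr_ge0.
rewrite limn_einf_lim; apply: lime_le; first exact: is_cvg_einfs.
apply: nearW => k; apply: ereal_inf_le; exists (\int[mu]_t h (k + n)%N t)%E.
  by exists (k + n)%N => //=; rewrite leq_addr.
by apply: fr; rewrite leq_addl.
Qed.

End RieszFischer.

Section Projection.
Context {R : realType}.
Notation mu := (circle_prob R).
Implicit Types (f g h : R -> R[i]) (z : R[i]) (M : set (R -> R[i])).

Definition linear_subspace M :=
  [/\ M `<=` L2, M (fun=> 0), forall f g, M f -> M g -> M (f \+ g) &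
      forall z f, M f -> M (z \*o f)].

Definition L2_closed M :=
  forall (h : nat -> R -> R[i]) g, (forall n, M (h n)) -> L2 g ->
    norm2 (g \- h n) @[n --> \oo] --> 0 -> M g.

(** Real and imaginary parts converge separately, each within [r n]; the sum 2 r^2 of the squared
    errors is bounded by (2 r)^2. *)
Lemma L2_fast_complete (h : nat -> R -> R[i]) (r : nat -> R) :
  (forall n, L2 (h n)) -> (forall n, 0 < r n) ->
  (\sum_(n <oo) (r n)%:E < +oo)%E ->
  (forall n m, (n <= m)%N -> norm2 (h m \- h n) <= r n) ->
  exists2 g, L2 g & forall n, norm2 (g \- h n) <= 2 * r n.
Proof.
move=> Lh r0 rsum hr.
have bound (k : nat -> R -> R) :
    (forall n m t, `|k m t - k n t| <= Normc.normc (h m t - h n t)) ->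
    (forall n, measurable_fun [set: R] (k n)) ->
    exists2 g : R -> R, measurable_fun [set: R] g &
    forall n, (\int[mu]_t ((g t - k n t) ^+ 2)%:E <= (r n ^+ 2)%:E)%E.
  move=> kh mk; apply: riesz_fischer_fast => // n m nm.
  have /L2P[mhh ihh] := L2B (Lh m) (Lh n).
  apply: (@le_trans _ _ (\int[mu]_t (Normc.normc (h m t - h n t) ^+ 2)%:E)%E).
    apply: ge0_le_integral => //.
    - by move=> t _; rewrite lee_fin sqr_ge0.
    - apply/measurable_EFinP/measurable_funX.
      exact: (measurable_funB (mk m) (mk n)).
    - by apply/measurable_EFinP; exact: (measurable_normc_sqr mhh).
    - move=> t _; rewrite lee_fin -(real_normK (num_real (_ - _))).
      by rewrite lerXn2r ?nnegrE ?normc_ge0//.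
  have -> : (\int[mu]_t (Normc.normc (h m t - h n t) ^+ 2)%:E)%E =
      (norm2 (h m \- h n) ^+ 2)%:E.
    by rewrite norm2_sqrE /Rintegral fineK// integrable_fin_num.
  by rewrite lee_fin lerXn2r ?nnegrE ?norm2_ge0 ?(ltW (r0 n))// hr.
have [g1 mg1 g1r] := bound (fun n t => complex.Re (h n t))
  (fun n m t => ltac:(by rewrite -cReB norm_Re_le)) (fun n => (L2_measurable (Lh n)).1).
have [g2 mg2 g2r] := bound (fun n t => complex.Im (h n t))
  (fun n m t => ltac:(by rewrite -cImB norm_Im_le)) (fun n => (L2_measurable (Lh n)).2).
pose g t := g1 t +i* g2 t.
have mg : cmeasurable g by split.
have gh n : (\int[mu]_t (Normc.normc ((g \- h n) t) ^+ 2)%:E <=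
    ((2 * r n) ^+ 2)%:E)%E.
  have [mh1 mh2] := L2_measurable (Lh n).
  under eq_integral => t _.
    rewrite normc_sqr /= cReB cImB EFinD; over.
  rewrite ge0_integralD//; first last.
  - apply/measurable_EFinP/measurable_funX.
    exact: (measurable_funB mg2 mh2).
  - by move=> t _; rewrite lee_fin sqr_ge0.
  - apply/measurable_EFinP/measurable_funX.
    exact: (measurable_funB mg1 mh1).
  - by move=> t _; rewrite lee_fin sqr_ge0.
  apply: (le_trans (leeD (g1r n) (g2r n))).
  by rewrite -EFinD lee_fin; have := sqr_ge0 (r n); nra.
have Lgh n : L2 (g \- h n).
  split; first exact: (cmeasurableB mg (L2_measurable (Lh n))).
  by apply: (le_lt_trans (gh n)); rewrite ltry.
exists g => [|n].
  rewrite (_ : g = (g \- h 0%N) \+ h 0%N); first exact: L2D.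
  by apply/funext => t; rewrite /= subrK.
rewrite -(@ler_pXn2r _ 2) ?nnegrE ?norm2_ge0 ?mulr_ge0 ?(ltW (r0 n))//.
rewrite norm2_sqrE -lee_fin /Rintegral fineK//.
by have /L2P[_ /(integrable_fin_num measurableT)] := Lgh n.
Qed.

Lemma norm2_triangle f g : L2 f -> L2 g -> norm2 (f \+ g) <= norm2 f + norm2 g.
Proof.
move=> Lf Lg; have f0 := norm2_ge0 f; have g0 := norm2_ge0 g.
rewrite -(@ler_pXn2r _ 2) ?nnegrE ?norm2_ge0 ?addr_ge0// norm2D_sqr//.
have := Re_inner_le Lf Lg; set c := complex.Re _ => cfg.
by rewrite sqrrD; lra.
Qed.

Lemma parallelogram f g : L2 f -> L2 g ->
  norm2 (f \+ g) ^+ 2 + norm2 (f \- g) ^+ 2 = 2 * norm2 f ^+ 2 + 2 * norm2 g ^+ 2.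
Proof. by move=> Lf Lg; rewrite norm2D_sqr// norm2B_sqr//; ring. Qed.

Lemma orthogonal_of_minimal M f g : linear_subspace M -> L2 f -> M g ->
  (forall h, M h -> norm2 (f \- g) <= norm2 (f \- h)) ->
  forall h, M h -> inner (f \- g) h = 0.
Proof.
move=> [ML M0 MD MZ] Lf Mg gmin h Mh.
have Lg := ML _ Mg; have Lh := ML _ Mh; have Lfg := L2B Lf Lg.
set c := inner (f \- g) h.
have key (s : R) : 0 <= s ^+ 2 * (Normc.normc c ^+ 2 * norm2 h ^+ 2) -
    2 * (s * Normc.normc c ^+ 2).
  (* Moving g in the direction c h, with c = <f - g, h>, makes the cross term the real number s
     |c|^2. *)
  have /gmin : M (g \+ ((s%:C * c) \*o h)) by apply: MD => //; exact: MZ.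
  have -> : f \- (g \+ ((s%:C * c) \*o h)) = (f \- g) \- ((s%:C * c) \*o h).
    by apply/funext => t; rewrite /= opprD addrA.
  rewrite -(@ler_pXn2r _ 2) ?nnegrE ?norm2_ge0//.
  have Lch := L2Z (s%:C * c) Lh.
  rewrite (norm2B_sqr Lfg Lch) norm2Z// innerZr// -/c conjC_realM.
  rewrite -mulrA (mulrC c^*) mulcJ Re_realM cReC Normc.normcM normc_real.
  rewrite !exprMn real_normK ?num_real//.
  by rewrite -addrA lerDl -mulrA.
apply: Normc.eq0_normc; apply/eqP; rewrite -sqrf_eq0; apply: contraT => c0.
have c2 : 0 < Normc.normc c ^+ 2 by rewrite lt_neqAle eq_sym c0 sqr_ge0.
have H0 := sqr_ge0 (norm2 h).
set N := norm2 h ^+ 2 in key H0; set C := Normc.normc c ^+ 2 in key c2.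
have N1 : 0 < N + 1 by rewrite ltr_wpDl.
(* The minimiser would be 1 / N; the shift by 1 covers h of norm 0 and still makes the expression
   negative. *)
have := key (N + 1)^-1.
have -> : (N + 1)^-1 ^+ 2 * (C * N) - 2 * ((N + 1)^-1 * C) =
    - (C * (N + 2) * (N + 1)^-1 ^+ 2).
  by field; rewrite lt0r_neq0.
rewrite oppr_ge0 leNgt => /negP[].
by rewrite mulr_gt0// ?exprn_gt0 ?invr_gt0// mulr_gt0// ltr_wpDl.
Qed.

(** A minimising sequence is Cauchy by the parallelogram law, because the midpoint of two of its
    terms stays in M. *)
Lemma projection_exists M f : linear_subspace M -> L2_closed M -> L2 f ->
  exists2 g, M g & forall h, M h -> inner (f \- g) h = 0.
Proof.
move=> sM cM Lf; have [ML M0 MD MZ] := sM.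
pose D := [set norm2 (f \- h) | h in M].
have Dinf : has_inf D.
  split; first by exists (norm2 (f \- (fun=> 0))), (fun=> 0).
  by exists 0 => _ [h _ <-]; exact: norm2_ge0.
pose d := inf D.
have dle h : M h -> d <= norm2 (f \- h).
  by move=> Mh; apply: (ge_inf Dinf.2); exists h.
have d0 : 0 <= d by apply: lb_le_inf => [|_ [h _ <-]]; [exact: Dinf.1|exact: norm2_ge0].
pose r n : R := 1 / (2 ^ n.+1)%:R.
have r0 n : 0 < r n by rewrite divr_gt0// ltr0n expn_gt0.
have rsum : (\sum_(n <oo) (r n)%:E < +oo)%E.
  by apply: (le_lt_trans (@epsilon_trick0 R 1 xpredT ler01)); exact: ltry.
(* The quality r^2 / 4 is what the parallelogram law needs: 2 r_n^2 / 4 + 2 r_m^2 / 4 <= r_n^2 for n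
   <= m. *)
have exh n : exists h, M h /\ norm2 (f \- h) ^+ 2 <= d ^+ 2 + r n ^+ 2 / 4.
  have e0 : 0 < Num.sqrt (d ^+ 2 + r n ^+ 2 / 4) - d.
    rewrite subr_gt0 -[ltLHS]ger0_norm// -sqrtr_sqr ltr_sqrt.
      by rewrite ltrDl divr_gt0// exprn_gt0.
    by rewrite ltr_wpDl ?sqr_ge0// divr_gt0// exprn_gt0.
  have [_ [h Mh <-]] := inf_adherent e0 Dinf; rewrite -/d addrC subrK => hd.
  exists h; split => //; rewrite -[leRHS]sqr_sqrtr.
    by rewrite lerXn2r ?nnegrE ?norm2_ge0 ?sqrtr_ge0 ?ltW.
  by rewrite addr_ge0 ?sqr_ge0// divr_ge0// sqr_ge0.
have [h hP] := choice exh.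
have Mh n := (hP n).1; have Lh n := ML _ (Mh n).
have rle n m : (n <= m)%N -> r m <= r n.
  move=> nm; rewrite ler_pM2l// lef_pV2 ?posrE ?ltr0n ?expn_gt0//.
  by rewrite ler_nat leq_exp2l.
have hc n m : (n <= m)%N -> norm2 (h m \- h n) <= r n.
  move=> nm; rewrite -(@ler_pXn2r _ 2) ?nnegrE ?norm2_ge0 ?(ltW (r0 n))//.
  have := parallelogram (L2B Lf (Lh n)) (L2B Lf (Lh m)).
  have -> : (f \- h n) \- (f \- h m) = h m \- h n.
    by apply/funext => t /=; rewrite opprB addrC addrA subrK.
  have -> : (f \- h n) \+ (f \- h m) = 2%:C \*o (f \- (2^-1%:C \*o (h n \+ h m))).
    apply/funext => t /=; rewrite mulrBr mulrA -(rmorphM (real_complex R)) /=.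
    by rewrite divff// rmorph1 mul1r rmorphMn rmorph1 mulr_natl opprD addrACA.
  have Mm : M (2^-1%:C \*o (h n \+ h m)) by apply/MZ/MD.
  rewrite norm2Z; last by apply: L2B => //; exact: ML.
  have := dle _ Mm; set x := norm2 (_ \- _) => dx.
  rewrite normc_real ger0_norm// exprMn => par.
  have dx2 : d ^+ 2 <= x ^+ 2 by rewrite lerXn2r ?nnegrE// (le_trans d0).
  have rr : r m ^+ 2 <= r n ^+ 2 by rewrite lerXn2r ?nnegrE ?(ltW (r0 _))// rle.
  have := (hP n).2; have := (hP m).2; move: par dx2 rr.
  set A := norm2 (f \- h n) ^+ 2; set B := norm2 (f \- h m) ^+ 2.
  by set E := norm2 _ ^+ 2; lra.
have [g Lg gh] := L2_fast_complete Lh r0 rsum hc.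
have rcvg : r @ \oo --> 0.
  have := @cvg_geometric R (2^-1) 2^-1; rewrite ger0_norm// invf_lt1// ltr1n.
  move=> /(_ isT); rewrite (_ : geometric _ _ = r)//.
  by apply/funext => n; rewrite /r /= div1r natrX exprS invfM exprVn.
have Mg : M g.
  apply: (cM h) => //; apply: (@squeeze_cvgr _ _ _ _ (fun=> 0) (fun n => 2 * r n)).
  - by apply: nearW => n; rewrite norm2_ge0 gh.
  - exact: cvg_cst.
  - by rewrite -[X in _ --> X](mulr0 (2 : R)); apply: cvgMr.
exists g => //; apply: orthogonal_of_minimal => // k Mk.
apply: le_trans (dle _ Mk); apply/ler_addgt0Pr => e e0.
(* The final error is r / 2 from minimality plus 2 r from completeness, that is 5 r / 2 < e. *)
have [n _ /(_ n (leqnn n)) rn] : \forall n \near \oo, r n < e / 3.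
  by apply: (cvgr_lt _ rcvg); rewrite divr_gt0.
have -> : f \- g = (f \- h n) \- (g \- h n).
  by apply/funext => t /=; rewrite opprB addrA subrK.
rewrite subf_addZ; apply: (le_trans (norm2_triangle _ _)).
- exact: L2B.
- by apply: L2Z; exact: L2B.
rewrite norm2Z ?normcN ?Normc.normc1 ?mul1r; last exact: L2B.
have := gh n; have := (hP n).2; have := norm2_ge0 (f \- h n); have := r0 n.
set A := norm2 (f \- h n); set B := norm2 (g \- h n) => rn0 A0 A2 Br.
suff : A <= d + r n / 2 by lra.
rewrite -(@ler_pXn2r _ 2) ?nnegrE ?addr_ge0 ?divr_ge0 ?(ltW rn0)//.
have dr : 0 <= d * r n by rewrite mulr_ge0// ltW.
by apply: (le_trans A2); rewrite sqrrD; lra.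
Qed.

End Projection.

(** * Goursat's argument *)

Section IntervalIntegral.
Context {R : realType}.
Implicit Types (f g : R -> R) (a b c x : R).

Definition itv_int f a b := Rintegral lebesgue_measure `[a, b] f.

Definition itv_continuous f a b := forall x, x \in `[a, b] -> {for x, continuous f}.

Lemma itv_continuousS f a b a' b' : a <= a' -> b' <= b ->
  itv_continuous f a b -> itv_continuous f a' b'.
Proof.
by move=> aa bb cf x; rewrite in_itv/= => /andP[ax xb]; apply: cf;
  rewrite in_itv/= (le_trans aa ax) (le_trans xb bb).
Qed.

Lemma itv_integrable f a b : itv_continuous f a b ->
  lebesgue_measure.-integrable `[a, b] (EFin \o f).
Proof.
move=> cf; apply: continuous_compact_integrable; first exact: segment_compact.
by apply: continuous_in_subspaceT => x; rewrite inE; exact: cf.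
Qed.

Lemma itv_intB f g a b : itv_continuous f a b -> itv_continuous g a b ->
  itv_int (fun x => f x - g x) a b = itv_int f a b - itv_int g a b.
Proof. by move=> cf cg; rewrite /itv_int RintegralB//; exact: itv_integrable. Qed.

Lemma itv_int_cst k a b : a <= b -> itv_int (fun=> k) a b = k * (b - a).
Proof.
move=> ab; rewrite /itv_int Rintegral_cst//= lebesgue_measure_itv/= lte_fin.
by move: ab; rewrite le_eqVlt => /orP[/eqP->|->]//; rewrite ltxx subrr.
Qed.

Lemma itv_int_split f a m b : a <= m -> m <= b -> itv_continuous f a b ->
  itv_int f a b = itv_int f a m + itv_int f m b.
Proof.
move=> am mb cf; apply/eqP; rewrite addrC -subr_eq /itv_int Rintegral_itvB//.
- rewrite Rintegral_itv_obnd_cbnd//.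
  have := itv_integrable (itv_continuousS am (lexx b) cf).
  by apply: integrableS => //; apply: subset_itvr; rewrite bnd_simp.
- exact: itv_integrable.
Qed.

Lemma itv_int_bound f K a b : a <= b -> itv_continuous f a b ->
  (forall x, x \in `[a, b] -> `|f x| <= K) -> `|itv_int f a b| <= K * (b - a).
Proof.
move=> ab cf fK; have fi := itv_integrable cf.
apply: (le_trans (le_normr_Rintegral _ fi)) => //.
rewrite -(itv_int_cst K ab); apply: le_Rintegral => //.
- exact: integrable_norm.
- by apply: itv_integrable => x _; exact: cvg_cst.
Qed.

End IntervalIntegral.

(** * Goursat's bisection for an additive functional of rectangles *)

Section Bisection.
Context {R : realType}.
Variables (Psi : R -> R -> R -> R -> R) (a b c d : R).
Hypotheses (ab : a <= b) (cd : c <= d).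
Hypothesis Psi_split : forall a' b' c' d' p q,
  a <= a' -> a' <= p -> p <= b' -> b' <= b ->
  c <= c' -> c' <= q -> q <= d' -> d' <= d ->
  Psi a' b' c' d' = Psi a' p c' q + Psi p b' c' q + Psi a' p q d' + Psi p b' q d'.
Hypothesis Psi_local : forall x y, x \in `[a, b] -> y \in `[c, d] ->
  forall e, 0 < e -> exists2 del, 0 < del &
  forall a' b' c' d', a <= a' -> b' <= b -> c <= c' -> d' <= d ->
    x \in `[a', b'] -> y \in `[c', d'] ->
    b' - a' < del -> d' - c' < del ->
    `|Psi a' b' c' d'| <= e * (b' - a' + (d' - c')) ^+ 2.

Let w n : R := (b - a) / 2 ^+ n.
Let h n : R := (d - c) / 2 ^+ n.

Let w_ge0 n : 0 <= w n.
Proof. by rewrite divr_ge0 ?subr_ge0// exprn_ge0. Qed.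
Let h_ge0 n : 0 <= h n.
Proof. by rewrite divr_ge0 ?subr_ge0// exprn_ge0. Qed.
Let wS n : w n = w n.+1 + w n.+1.
Proof. by rewrite /w exprS; field; rewrite expf_neq0. Qed.
Let hS n : h n = h n.+1 + h n.+1.
Proof. by rewrite /h exprS; field; rewrite expf_neq0. Qed.

Let valid n (p : R * R) :=
  [/\ a <= p.1, p.1 + w n <= b, c <= p.2 & p.2 + h n <= d].

Let cell n (p : R * R) := Psi p.1 (p.1 + w n) p.2 (p.2 + h n).

(** One of the four quarters carries at least a quarter of the value. The premise [valid n p] stands
    under the existential so that [choice] yields a total successor map; (0, 0) is a default off the
    valid cells. *)
Let step n p : exists q, valid n p ->
  [/\ valid n.+1 q, p.1 <= q.1 <= p.1 + w n.+1, p.2 <= q.2 <= p.2 + h n.+1 &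
      `|cell n p| <= 4 * `|cell n.+1 q|].
Proof.
case: p => x y /=; have [vp|nv] := pselect (valid n (x, y)); last by exists (0, 0).
have [/= ax xb cy yd] := vp.
have w0 := w_ge0 n.+1; have h0 := h_ge0 n.+1.
have Wn := wS n; have Hn := hS n.
have eqS : cell n (x, y) = cell n.+1 (x, y) + cell n.+1 (x + w n.+1, y) +
    cell n.+1 (x, y + h n.+1) + cell n.+1 (x + w n.+1, y + h n.+1).
  rewrite /cell /=.
  have -> : x + w n.+1 + w n.+1 = x + w n by rewrite -addrA -wS.
  have -> : y + h n.+1 + h n.+1 = y + h n by rewrite -addrA -hS.
  by apply: Psi_split => //; lra.
have sub4 (A B C D : R) : `|A + B + C + D| <= 4 * `|A| \/
    `|A + B + C + D| <= 4 * `|B| \/ `|A + B + C + D| <= 4 * `|C| \/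
    `|A + B + C + D| <= 4 * `|D|.
  have : `|A + B + C + D| <= `|A| + `|B| + `|C| + `|D|.
    apply: (le_trans (ler_normD _ _)); rewrite lerD2r.
    by apply: (le_trans (ler_normD _ _)); rewrite lerD2r; exact: ler_normD.
  set S := `|A + B + C + D|.
  have [?|?] := leP S (4 * `|A|); first by left.
  have [?|?] := leP S (4 * `|B|); first by right; left.
  have [?|?] := leP S (4 * `|C|); first by right; right; left.
  have [?|?] := leP S (4 * `|D|); first by right; right; right.
  by lra.
have := sub4 (cell n.+1 (x, y)) (cell n.+1 (x + w n.+1, y))
  (cell n.+1 (x, y + h n.+1)) (cell n.+1 (x + w n.+1, y + h n.+1)).
rewrite -eqS => -[|[|[|]]] le4;
  [exists (x, y)|exists (x + w n.+1, y)|exists (x, y + h n.+1)|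
   exists (x + w n.+1, y + h n.+1)] => _; split => //=; rewrite ?/valid/=; try split; lra.
Qed.

(** The chosen cells shrink to a point, where [Psi_local] bounds the n-th value by e (L / 2^n)^2;
    the factor 4^n lost in the descent cancels exactly. *)
Lemma bisection_eq0 : Psi a b c d = 0.
Proof.
have [nxt nxtP] := choice (fun np : nat * (R * R) => step np.1 np.2).
pose p := fix p n := if n is m.+1 then nxt (m, p m) else (a, c).
have vp n : valid n (p n).
  elim: n => [|n IH]; last by have [] := nxtP (n, p n) IH.
  by rewrite /valid/= /w /h !expr0 !divr1 !subrKC.
have x_step n : (p n).1 <= (p n.+1).1 <= (p n).1 + w n.+1.
  by have [_ ] := nxtP (n, p n) (vp n).
have y_step n : (p n).2 <= (p n.+1).2 <= (p n).2 + h n.+1.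
  by have [_ _] := nxtP (n, p n) (vp n).
have cell_le n : `|Psi a b c d| <= 4 ^+ n * `|cell n (p n)|.
  elim: n => [|n IH].
    by rewrite expr0 mul1r /cell /= /w /h !expr0 !divr1 !subrKC.
  have [_ _ _ le4] := nxtP (n, p n) (vp n).
  apply: (le_trans IH); rewrite exprSr -mulrA ler_wpM2l// exprn_ge0//.
(* Lower endpoints increase and stay below every upper endpoint, so their supremum lies in all the
   intervals. *)
have limit (s v : nat -> R) : (forall n, 0 <= v n) -> (forall n, v n = v n.+1 + v n.+1) ->
    (forall n, s n <= s n.+1 <= s n + v n.+1) ->
    exists x, forall n, s n <= x <= s n + v n.
  move=> v0 vS sS.
  have mono n k : s n <= s (n + k)%N /\ s (n + k)%N + v (n + k)%N <= s n + v n.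
    elim: k => [|k [IH1 IH2]]; first by rewrite addn0.
    have /andP[h1 h2] := sS (n + k)%N; have h3 := vS (n + k)%N.
    by rewrite addnS; split; lra.
  have le_all n m : s m <= s n + v n.
    have [nm|mn] := leqP n m.
      have := (mono n (m - n)%N).2; rewrite subnKC//.
      by have := v0 m; lra.
    have := (mono m (n - m)%N).1; rewrite subnKC 1?ltnW//.
    by have := v0 n; lra.
  exists (sup (range s)) => n; apply/andP; split.
    apply: ub_le_sup; last by exists n.
    by exists (s 0%N + v 0%N) => _ [m _ <-].
  by apply: ge_sup; [exists (s 0%N), 0%N|move=> _ [m _ <-]].
have [x xP] := limit _ _ w_ge0 wS x_step.
have [y yP] := limit _ _ h_ge0 hS y_step.
have xab : x \in `[a, b].
  have := xP 0%N; have [] := vp 0%N; rewrite in_itv /=; lra.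
have ycd : y \in `[c, d].
  have := yP 0%N; have [] := vp 0%N; rewrite in_itv /=; lra.
apply/eqP; rewrite -normr_le0; apply/ler_addgt0Pr => e e0; rewrite add0r.
pose L := b - a + (d - c).
have L0 : 0 <= L by rewrite addr_ge0// subr_ge0.
(* The added 1 avoids division by 0 for a rectangle reduced to a point. *)
have e1 : 0 < e / (L ^+ 2 + 1) by rewrite divr_gt0// ltr_wpDl ?sqr_ge0.
have [del del0 delP] := Psi_local xab ycd e1.
have vcvg (k : R) : (fun n => k / 2 ^+ n) @ \oo --> 0.
  have := @cvg_geometric R k 2^-1; rewrite ger0_norm ?invr_ge0// invf_lt1 ?ltr1n//.
  move=> /(_ isT); rewrite (_ : geometric _ _ = (fun n => k / 2 ^+ n))//.
  by apply/funext => n; rewrite /= exprVn.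
have [n1 _ /(_ _ (leq_maxl n1 _)) wn] : \forall n \near \oo, w n < del.
  exact: (cvgr_lt _ (vcvg _)).
have [n2 _ /(_ _ (leq_maxr _ n2)) hn] : \forall n \near \oo, h n < del.
  exact: (cvgr_lt _ (vcvg _)).
have {wn} wn := wn n2; have {hn} hn := hn n1; set n := maxn n1 n2 in wn hn.
have [v1 v2 v3 v4] := vp n.
have := delP (p n).1 ((p n).1 + w n) (p n).2 ((p n).2 + h n) v1 v2 v3 v4.
rewrite !in_itv /= xP yP => /(_ isT isT).
have -> : (p n).1 + w n - (p n).1 = w n by rewrite addrAC subrr add0r.
have -> : (p n).2 + h n - (p n).2 = h n by rewrite addrAC subrr add0r.
move=> /(_ wn hn) small.
apply: (le_trans (cell_le n)); rewrite /cell.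
apply: (@le_trans _ _ (4 ^+ n * (e / (L ^+ 2 + 1) * (w n + h n) ^+ 2))).
  by rewrite ler_wpM2l// exprn_ge0.
have -> : w n + h n = L / 2 ^+ n by rewrite /w /h /L -mulrDl.
have -> : 4 ^+ n * (e / (L ^+ 2 + 1) * (L / 2 ^+ n) ^+ 2) = e * (L ^+ 2 / (L ^+ 2 + 1)).
  have -> : (4 : R) ^+ n = (2 ^+ n) ^+ 2.
    by rewrite -[RHS]exprM mulnC exprM; congr (_ ^+ n); ring.
  have : (2 : R) ^+ n != 0 by rewrite expf_neq0.
  have : L ^+ 2 + 1 != 0 by rewrite gt_eqF// ltr_wpDl ?sqr_ge0.
  by move=> h1 h2; field; rewrite h1 h2.
rewrite -[leRHS]mulr1 ler_pM2l// ler_pdivrMr ?mul1r ?lerDl//.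
by rewrite ltr_wpDl ?sqr_ge0.
Qed.

End Bisection.

(** * Circulation of a closed form around a rectangle *)

Section Green.
Context {R : realType}.
Implicit Types (F P Q : R -> R -> R).

(** Differentiability with gradient (A, B). *)
Definition affine_approx F x0 y0 A B := forall e : R, 0 < e ->
  exists2 del : R, 0 < del & forall x y, `|x - x0| < del -> `|y - y0| < del ->
    `|F x y - (F x0 y0 + A * (x - x0) + B * (y - y0))| <=
      e * (`|x - x0| + `|y - y0|).

Lemma affine_approx_continuous1 (f : R -> R) (x0 k : R) :
  (exists2 del, 0 < del & forall x, `|x - x0| < del ->
    `|f x - (f x0 + k * (x - x0))| <= `|x - x0|) -> {for x0, continuous f}.
Proof.
move=> [del del0 fdel]; apply/cvgrPdist_lt => e e0.
have k1 : 0 < `|k| + 2 by rewrite ltr_wpDl.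
exists (Num.min del (e / (`|k| + 2))) => /= [|x].
  by rewrite lt_min del0 divr_gt0.
rewrite /= lt_min !(distrC x0) => /andP[xdel xe].
rewrite (distrC (f x0)); have := fdel x xdel; rewrite ltr_pdivlMr// in xe.
have -> : f x - f x0 = (f x - (f x0 + k * (x - x0))) + k * (x - x0) by ring.
move=> h; apply: (le_lt_trans (ler_normD _ _)); rewrite normrM.
have := normr_ge0 k; have := normr_ge0 (x - x0); nra.
Qed.

Lemma affine_approx_contx F x0 y0 A B : affine_approx F x0 y0 A B ->
  {for x0, continuous (F ^~ y0)}.
Proof.
move=> /(_ 1 ltr01)[del del0 Fdel].
apply: (@affine_approx_continuous1 _ _ A); exists del => // x xdel.
have := Fdel x y0 xdel; rewrite subrr normr0 mulr0 !addr0 mul1r; exact.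
Qed.

Lemma affine_approx_conty F x0 y0 A B : affine_approx F x0 y0 A B ->
  {for y0, continuous (F x0)}.
Proof.
move=> /(_ 1 ltr01)[del del0 Fdel].
apply: (@affine_approx_continuous1 _ _ B); exists del => // y ydel.
have := Fdel x0 y; rewrite subrr normr0 mulr0 addr0 add0r mul1r; exact.
Qed.

(** The counterclockwise line integral of P dx + Q dy along the boundary of [a, b] x [c, d]. *)
Definition circulation P Q a b c d :=
  itv_int (P ^~ c) a b - itv_int (P ^~ d) a b +
  (itv_int (Q b) c d - itv_int (Q a) c d).

(* Differentiability without continuity of the derivative is enough, by
   Goursat's bisection. *)
Lemma circulation_eq0 P Q a b c d : a <= b -> c <= d ->
  (forall x y, x \in `[a, b] -> y \in `[c, d] ->
    exists A B C, affine_approx P x y A B /\ affine_approx Q x y B C) ->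
  circulation P Q a b c d = 0.
Proof.
move=> ab cd PQ.
have contP y : y \in `[c, d] -> itv_continuous (P ^~ y) a b.
  by move=> yd x xb; have [A [B [C [/affine_approx_contx]]]] := PQ x y xb yd.
have contQ x : x \in `[a, b] -> itv_continuous (Q x) c d.
  by move=> xb y yd; have [A [B [C [_ /affine_approx_conty]]]] := PQ x y xb yd.
apply: bisection_eq0 ab cd _ _ => [a' b' c' d' p q aa ap pb bb cc cq qd dd|].
  have cP y u v : c <= y <= d -> a <= u -> v <= b -> itv_continuous (P ^~ y) u v.
    by move=> yd au vb; apply: itv_continuousS au vb _; apply: contP.
  have cQ x u v : a <= x <= b -> c <= u -> v <= d -> itv_continuous (Q x) u v.
    by move=> xb cu vd; apply: itv_continuousS cu vd _; apply: contQ.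
  rewrite /circulation.
  rewrite (@itv_int_split _ (P ^~ c') a' p b')//; last by apply: cP => //; lra.
  rewrite (@itv_int_split _ (P ^~ d') a' p b')//; last by apply: cP => //; lra.
  rewrite (@itv_int_split _ (Q b') c' q d')//; last by apply: cQ => //; lra.
  rewrite (@itv_int_split _ (Q a') c' q d')//; last by apply: cQ => //; lra.
  by ring.
move=> x y xb yd e e0.
have [A [B [C [Pj Qj]]]] := PQ x y xb yd.
have e2 : 0 < e / 2 by rewrite divr_gt0.
have [d1 d10 Pd] := Pj _ e2; have [d2 d20 Qd] := Qj _ e2.
exists (Num.min d1 d2); first by rewrite lt_min d10.
move=> a' b' c' d' aa bb cc dd; rewrite !in_itv /= => /andP[ax xb'] /andP[cy yd'].
rewrite !lt_min => /andP[w1 w2] /andP[h1 h2].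
have ab' : a' <= b' by exact: le_trans xb'.
have cd' : c' <= d' by exact: le_trans yd'.
have cP z : c' <= z <= d' -> itv_continuous (P ^~ z) a' b'.
  by move=> zd; apply: itv_continuousS aa bb _; apply: contP; rewrite in_itv /=; lra.
have cQ z : a' <= z <= b' -> itv_continuous (Q z) c' d'.
  by move=> zd; apply: itv_continuousS cc dd _; apply: contQ; rewrite in_itv /=; lra.
have dist (u v z s : R) : u <= z <= v -> u <= s <= v -> `|s - z| <= v - u.
  by move=> uz us; rewrite ler_norml; lra.
pose W := b' - a'; pose H := d' - c'.
(* B is both the y-derivative of P and the x-derivative of Q. Its contributions to the horizontal
   and vertical pairs of sides are opposite, so subtracting both leaves the circulation unchanged
   and only error terms in the integrands. *)
have Pint : `|itv_int (fun s => P s c' - P s d' - B * (c' - d')) a' b'| <=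
    e * (W + H) * W.
  apply: itv_int_bound => // [s sb|s].
    apply: cvgB; last exact: cvg_cst.
    by apply: cvgB; apply: cP => //; rewrite lexx ?cd'.
  rewrite in_itv /= => sb.
  have sx : `|s - x| <= W by apply: dist => //; rewrite ax.
  have cy' : `|c' - y| <= H by apply: dist; rewrite ?cy ?lexx.
  have dy' : `|d' - y| <= H by apply: dist; rewrite ?cy ?lexx ?andbT.
  have hc := Pd s c' (le_lt_trans sx w1) (le_lt_trans cy' h1).
  have hd := Pd s d' (le_lt_trans sx w1) (le_lt_trans dy' h1).
  set u := P s c' - _ in hc; set v := P s d' - _ in hd.
  have -> : P s c' - P s d' - B * (c' - d') = u - v by rewrite /u /v; ring.
  by apply: (le_trans (ler_normB _ _)); nra.
have Qint : `|itv_int (fun s => Q b' s - Q a' s - B * (b' - a')) c' d'| <=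
    e * (W + H) * H.
  apply: itv_int_bound => // [s sb|s].
    apply: cvgB; last exact: cvg_cst.
    by apply: cvgB; apply: cQ => //; rewrite lexx ?ab'.
  rewrite in_itv /= => sb.
  have sx : `|s - y| <= H by apply: dist => //; rewrite cy.
  have ax' : `|a' - x| <= W by apply: dist; rewrite ?ax ?lexx.
  have bx' : `|b' - x| <= W by apply: dist; rewrite ?ax ?lexx ?andbT.
  have ha := Qd a' s (le_lt_trans ax' w2) (le_lt_trans sx h2).
  have hb := Qd b' s (le_lt_trans bx' w2) (le_lt_trans sx h2).
  set u := Q b' s - _ in hb; set v := Q a' s - _ in ha.
  have -> : Q b' s - Q a' s - B * (b' - a') = u - v by rewrite /u /v; ring.
  by apply: (le_trans (ler_normB _ _)); nra.
have -> : circulation P Q a' b' c' d' =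
    itv_int (fun s => P s c' - P s d' - B * (c' - d')) a' b' +
    itv_int (fun s => Q b' s - Q a' s - B * (b' - a')) c' d'.
  have cst k u v : itv_continuous (fun _ : R => k) u v by move=> z _; exact: cvg_cst.
  have cP1 : itv_continuous (P ^~ c') a' b' by apply: cP; rewrite lexx.
  have cP2 : itv_continuous (P ^~ d') a' b' by apply: cP; rewrite lexx andbT.
  have cQ1 : itv_continuous (Q a') c' d' by apply: cQ; rewrite lexx.
  have cQ2 : itv_continuous (Q b') c' d' by apply: cQ; rewrite lexx andbT.
  rewrite /circulation !itv_intB// ?itv_int_cst//; first ring.
  - by move=> z zb; apply: cvgB; [exact: cQ2|exact: cQ1].
  - by move=> z zb; apply: cvgB; [exact: cP1|exact: cP2].
apply: (le_trans (ler_normD _ _)); apply: (le_trans (lerD Pint Qint)).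
by rewrite -mulrDr -mulrA -expr2.
Qed.

End Green.

(** * Cauchy's theorem for periodic holomorphic functions *)

Section HolomorphicEstimate.
Context {R : realType}.
Implicit Types (g : R[i] -> R[i]) (w z : R[i]).

(** Complex derivative with real tolerances, because the norm of [R[i]] takes its values in
    [R[i]]. *)
Definition has_cderiv g z c := forall e : R, 0 < e ->
  exists2 del : R, 0 < del & forall w, Normc.normc (w - z) < del ->
    Normc.normc (g w - g z - c * (w - z)) <= e * Normc.normc (w - z).

(** These are the Cauchy-Riemann equations. The third item serves the form U dx - V dy, whose second
    coefficient is -V. *)
Lemma has_cderiv_affine_approx g (s t : R) c : has_cderiv g (s +i* t) c ->
  let U s t := complex.Re (g (s +i* t)) in let V s t := complex.Im (g (s +i* t)) in
  [/\ affine_approx U s t (complex.Re c) (- complex.Im c),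
      affine_approx V s t (complex.Im c) (complex.Re c) &
      affine_approx (fun s t => - V s t) s t (- complex.Im c) (- complex.Re c)].
Proof.
move=> gc U V.
have est e : 0 < e -> exists2 del : R, 0 < del & forall x y,
    `|x - s| < del -> `|y - t| < del ->
    Normc.normc (g (x +i* y) - g (s +i* t) - c * ((x - s) +i* (y - t))) <=
    e * (`|x - s| + `|y - t|).
  move=> e0; have [del del0 gdel] := gc e e0.
  exists (del / 2); first by rewrite divr_gt0.
  move=> x y xs yt.
  have le1 : Normc.normc ((x +i* y) - (s +i* t)) <= `|x - s| + `|y - t|.
    exact: normc_le_ReIm.
  have /gdel : Normc.normc ((x +i* y) - (s +i* t)) < del.
    by apply: (le_lt_trans le1); lra.
  by move=> h; apply: (le_trans h); rewrite ler_wpM2l// ltW.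
have ReE x y : U x y - (U s t + complex.Re c * (x - s) + - complex.Im c * (y - t)) =
    complex.Re (g (x +i* y) - g (s +i* t) - c * ((x - s) +i* (y - t))).
  by rewrite !cReB cReM /U /=; ring.
have ImE x y : V x y - (V s t + complex.Im c * (x - s) + complex.Re c * (y - t)) =
    complex.Im (g (x +i* y) - g (s +i* t) - c * ((x - s) +i* (y - t))).
  by rewrite !cImB cImM /V /=; ring.
split=> e e0; have [del del0 gdel] := est e e0; exists del => // x y xs yt;
  apply: le_trans (gdel x y xs yt).
- by rewrite ReE norm_Re_le.
- by rewrite ImE norm_Im_le.
- rewrite (_ : - V x y - (- V s t + - complex.Im c * (x - s) +
    - complex.Re c * (y - t)) = - (V x y - (V s t + complex.Im c * (x - s) +
    complex.Re c * (y - t)))); last by ring.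
  by rewrite normrN ImE norm_Im_le.
Qed.

(** With g = U + i V, the form g dz has real part U dx - V dy and imaginary part V dx + U dy, both
    of circulation 0. Periodicity cancels the horizontal sides of [a, b] x [0, T], so the two
    vertical integrals agree. *)
Lemma cauchy_periodic g (a b T : R) : a <= b -> 0 <= T ->
  (forall s t, s \in `[a, b] -> exists c, has_cderiv g (s +i* t) c) ->
  (forall s t, g (s +i* (t + T)) = g (s +i* t)) ->
  itv_int (fun t => complex.Re (g (a +i* t))) 0 T =
    itv_int (fun t => complex.Re (g (b +i* t))) 0 T /\
  itv_int (fun t => complex.Im (g (a +i* t))) 0 T =
    itv_int (fun t => complex.Im (g (b +i* t))) 0 T.
Proof.
move=> ab T0 gd gT.
pose U s t := complex.Re (g (s +i* t)); pose V s t := complex.Im (g (s +i* t)).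
have approx s t : s \in `[a, b] -> exists A B,
    [/\ affine_approx U s t A (- B), affine_approx V s t B A &
        affine_approx (fun s t => - V s t) s t (- B) (- A)].
  move=> /(gd s t)[c /has_cderiv_affine_approx gc].
  by exists (complex.Re c), (complex.Im c).
have UT s : U s T = U s 0 by rewrite /U -[X in _ +i* X]add0r gT.
have VT s : V s T = V s 0 by rewrite /V -[X in _ +i* X]add0r gT.
split; apply/esym/eqP; rewrite -subr_eq0; apply/eqP.
  have : circulation V U a b 0 T = 0.
    apply: circulation_eq0 => // x y xb _; have [A [B [h1 h2 _]]] := approx x y xb.
    by exists B, A, (- B).
  rewrite /circulation; have -> : V ^~ T = V ^~ 0 by apply/funext.
  by rewrite subrr add0r.
have : circulation U (fun s t => - V s t) a b 0 T = 0.
  apply: circulation_eq0 => // x y xb _; have [A [B [h1 _ h3]]] := approx x y xb.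
  by exists A, (- B), (- A).
have itv_intN s : s \in `[a, b] ->
    itv_int (fun t => - V s t) 0 T = - itv_int (V s) 0 T.
  move=> sb; rewrite (_ : (fun t => - V s t) = (fun t => 0 - V s t)); last first.
    by apply/funext => t; rewrite sub0r.
  rewrite itv_intB ?itv_int_cst ?mul0r ?sub0r// => t _; first exact: cvg_cst.
  by have [A [B [_ /affine_approx_conty]]] := approx s t sb.
rewrite /circulation; have -> : U ^~ T = U ^~ 0 by apply/funext.
rewrite subrr add0r !itv_intN ?in_itv /= ?lexx ?ab// opprK addrC => /eqP.
by rewrite subr_eq0 => /eqP ->; rewrite subrr.
Qed.

End HolomorphicEstimate.

(** * The logarithmic coordinate on the disc *)

Section DerivativeEstimate.
Context {K : numFieldType}.
Implicit Types (f : K^o -> K^o) (x c : K).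

Lemma derivative_estimate f x c : is_derive x 1 f c ->
  forall e, 0 < e -> exists2 d, 0 < d &
  forall y, `|y - x| < d -> `|f y - f x - c * (y - x)| <= e * `|y - x|.
Proof.
move=> [+ <-] e e0; rewrite /derivable /derive.
move=> /cvgrPdist_le/(_ e e0)[d /= d0]; set c' := lim _ => de.
exists d => // y yd; have [->|yx] := eqVneq y x.
  by rewrite !subrr mulr0 subr0 normr0 mulr0.
have h0 : y - x != 0 by rewrite subr_eq0.
have := de (y - x); rewrite /ball_ /= sub0r normrN => /(_ yd h0).
rewrite -[(y - x) *: 1]/((y - x) * 1) mulr1 subrK => le_e.
have -> : f y - f x - c' * (y - x) = - ((y - x) * (c' - (y - x)^-1 * (f y - f x))).
  by field.
by rewrite normrN normrM mulrC ler_wpM2r.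
Qed.

Lemma estimate_derivable f x c : (forall e, 0 < e -> exists2 d, 0 < d &
    forall y, `|y - x| < d -> `|f y - f x - c * (y - x)| <= e * `|y - x|) ->
  derivable f x 1.
Proof.
move=> fc; apply/cvg_ex; exists c; apply/cvgrPdist_le => e e0.
have [d d0 de] := fc e e0; exists d => //= h; rewrite /ball_ /= sub0r normrN => hd h0.
have := de (h + x); rewrite addrK => /(_ hd) le_e.
rewrite -[h *: 1]/(h * 1) mulr1 -[_ *: _]/(h^-1 * (f (h + x) - f x)).
have -> : c - h^-1 * (f (h + x) - f x) = - (h^-1 * (f (h + x) - f x - c * h)).
  by field.
by rewrite normrN normrM normfV mulrC ler_pdivrMr ?normr_gt0.
Qed.

End DerivativeEstimate.

Section ComplexExponential.
Context {R : realType}.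
Implicit Types (z w h : R[i]).

Lemma gt0_complexE (e : R[i]) : 0 < e -> e = (complex.Re e)%:C /\ 0 < complex.Re e.
Proof. by case: e => a b; rewrite ltcE /= => /andP[/eqP -> ->]. Qed.

Lemma derivable_has_cderiv (f : R[i]^o -> R[i]^o) z : derivable f z 1 ->
  exists c, has_cderiv f z c.
Proof.
move=> /derivableP/derivative_estimate fc; exists ('D_1 f z) => e e0.
have /fc[d d0 dP] : 0 < e%:C by rewrite ltcR.
have [dE d1] := gt0_complexE d0; exists (complex.Re d) => // w wd.
have := dP w; rewrite !normc_norm dE -rmorphM /= !lecR ltcR; exact.
Qed.

Lemma has_cderiv_derivable (f : R[i]^o -> R[i]^o) z c : has_cderiv f z c ->
  derivable f z 1.
Proof.
move=> fc; apply: (@estimate_derivable _ _ _ c) => e /gt0_complexE[eE e0].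
have [d d0 dP] := fc _ e0; exists d%:C; first by rewrite ltcR.
move=> w; rewrite eE !normc_norm -rmorphM /= !lecR ltcR; exact: dP.
Qed.

Definition cexp z : R[i] := (expR (complex.Re z))%:C * expi (complex.Im z).

Lemma expiD (s t : R) : expi (s + t) = expi s * expi t.
Proof.
apply: complex_ext; rewrite ?cReM ?cImM /expi /= ?cosD ?sinD//.
by rewrite addrC mulrC [X in _ + X]mulrC addrC.
Qed.

Lemma expi0 : expi 0 = 1 :> R[i].
Proof. by rewrite /expi cos0 sin0. Qed.

Lemma normc_expi (t : R) : Normc.normc (expi t) = 1.
Proof. by rewrite /Normc.normc /expi cos2Dsin2 sqrtr1. Qed.

Lemma expiN (t : R) : expi (- t) = (expi t)^*.
Proof. by apply: complex_ext; rewrite ?cReJ ?cImJ /expi /= ?cosN ?sinN. Qed.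

Lemma expi_2pi (t : R) : expi (t + 2 * pi) = expi t.
Proof. by rewrite /expi mulr_natl cosD2pi sinD2pi. Qed.

Lemma cexpD z w : cexp (z + w) = cexp z * cexp w.
Proof.
rewrite /cexp cReD cImD expRD expiD rmorphM /=.
by rewrite -!mulrA; congr (_ * _); rewrite mulrCA.
Qed.

Lemma normc_cexp z : Normc.normc (cexp z) = expR (complex.Re z).
Proof. by rewrite /cexp Normc.normcM normc_expi mulr1 normc_real ger0_norm ?expR_ge0. Qed.

Lemma cexp_estimate0 (e : R) : 0 < e -> exists2 d : R, 0 < d &
  forall h, Normc.normc h < d ->
  Normc.normc (cexp h - 1 - h) <= e * Normc.normc h.
Proof.
move=> e0.
(* The four error terms below are at most 2, 1, 2 and 2 times k N, whence 7. The condition 2 k <= 1,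
   with N < k, gives |exp a - 1| <= 2 k <= 1 and so exp a <= 2. *)
have [k [k0 ke k1]] : exists k : R, [/\ 0 < k, 7 * k <= e & 2 * k <= 1].
  exists (Num.min (e / 7) (1 / 2)); split; first by rewrite lt_min !divr_gt0.
    by rewrite mulrC -ler_pdivlMr// ge_min lexx.
  by rewrite mulrC -ler_pdivlMr// ge_min lexx orbT.
have [d1 d10 hexp] := derivative_estimate (is_derive_expR (0 : R^o)) k0.
have [d2 d20 hcos] := derivative_estimate (is_derive_cos (0 : R^o)) k0.
have [d3 d30 hsin] := derivative_estimate (is_derive_sin (0 : R^o)) k0.
exists (Num.min (Num.min d1 d2) (Num.min d3 k)).
  by rewrite !lt_min d10 d20 d30 k0.
move=> [a b]; set N := Normc.normc _.
have aN : `|a| <= N by exact: (norm_Re_le (a +i* b)).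
have bN : `|b| <= N by exact: (norm_Im_le (a +i* b)).
rewrite !lt_min -andbA => /and4P[N1 N2 N3 Nk].
have := hexp a; have := hcos b; have := hsin b.
rewrite !subr0 expR0 cos0 sin0 oppr0 mul0r !mul1r !subr0 !addr0.
move=> /(_ (le_lt_trans bN N3)) hs /(_ (le_lt_trans bN N2)) hc
  /(_ (le_lt_trans aN N1)) he.
have re : complex.Re (cexp (a +i* b) - 1 - (a +i* b)) =
    expR a * (cos b - 1) + (expR a - 1 - a).
  by rewrite /cexp !cReB cReM /=; ring.
have im : complex.Im (cexp (a +i* b) - 1 - (a +i* b)) =
    expR a * (sin b - b) + (expR a - 1) * b.
  by rewrite /cexp !cImB cImM /=; ring.
apply: (le_trans (normc_le_ReIm _)); rewrite re im.
have E0 := expR_ge0 a; have a0 := normr_ge0 a; have b0 := normr_ge0 b.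
have e1 : `|expR a - 1| <= 2 * k.
  have -> : expR a - 1 = (expR a - 1 - a) + a by ring.
  by apply: (le_trans (ler_normD _ _)); nra.
have E2 : expR a <= 2 by move: e1; rewrite ler_norml; lra.
have t1 : `|expR a * (cos b - 1)| <= 2 * (k * N).
  rewrite normrM (ger0_norm E0); apply: ler_pM => //.
  by apply: (le_trans hc); rewrite ler_wpM2l// ltW.
have t2 : `|expR a - 1 - a| <= k * N.
  by apply: (le_trans he); rewrite ler_wpM2l// ltW.
have t3 : `|expR a * (sin b - b)| <= 2 * (k * N).
  rewrite normrM (ger0_norm E0); apply: ler_pM => //.
  by apply: (le_trans hs); rewrite ler_wpM2l// ltW.
have t4 : `|(expR a - 1) * b| <= 2 * k * N by rewrite normrM; apply: ler_pM.
have N0 : 0 <= N by exact: normc_ge0.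
have := ler_normD (expR a * (cos b - 1)) (expR a - 1 - a).
have := ler_normD (expR a * (sin b - b)) ((expR a - 1) * b).
nra.
Qed.

Lemma derivable_cexp z : derivable (cexp : R[i]^o -> R[i]^o) z 1.
Proof.
apply: (@has_cderiv_derivable _ _ (cexp z)) => e e0.
have E0 : 0 < expR (complex.Re z) by exact: expR_gt0.
have [d d0 dP] := cexp_estimate0 (divr_gt0 e0 E0).
exists d => // w /dP le_e.
have -> : cexp w - cexp z - cexp z * (w - z) =
    cexp z * (cexp (w - z) - 1 - (w - z)).
  have {1}-> : w = z + (w - z) by rewrite addrC subrK.
  by rewrite cexpD; ring.
rewrite Normc.normcM normc_cexp; have := ler_wpM2l (ltW E0) le_e.
by rewrite mulrA mulrCA divff ?mulr1// gt_eqF.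
Qed.

(** The half-plane Re z < 0 is mapped into the disc minus the origin, so the factor exp(n w), a
    power of [cexp w], causes no trouble even for negative n. *)
Lemma log_coordinate_cderiv (u : R[i] -> R[i]) (n : int) z : analytic_disc u ->
  complex.Re z < 0 ->
  exists c, has_cderiv (fun w => u (cexp w) * cexp (n%:~R * w)) z c.
Proof.
move=> au z0; apply: derivable_has_cderiv; apply/derivable1_diffP.
have du : differentiable (u : R[i]^o -> R[i]^o) (cexp z : R[i]^o).
  by apply/derivable1_diffP/au; rewrite normc_norm ltcR normc_cexp expR_lt1.
have de (w : R[i]^o) : differentiable (cexp : R[i]^o -> R[i]^o) w.
  exact/derivable1_diffP/derivable_cexp.
apply: differentiableM; first exact: (differentiable_comp (de z) du).
have dm : differentiable (fun w : R[i]^o => n%:~R * w : R[i]^o) (z : R[i]^o).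
  apply/derivable1_diffP/(@has_cderiv_derivable _ _ n%:~R) => e e0.
  exists 1 => // w _.
  have -> : n%:~R * w - n%:~R * z - n%:~R * (w - z) = 0%:C by rewrite mulrBr subrr.
  by rewrite normc_real normr0 mulr_ge0 ?normc_ge0 ?ltW.
exact: (differentiable_comp dm (de _)).
Qed.

End ComplexExponential.

(** * Limits of vanishing integrals, and the circle as an interval *)

Section DominatedConvergence.
Context {R : realType}.
Notation mu := (circle_prob R).

Lemma Rintegral_dominated0 (f_ : nat -> R -> R) (f g : R -> R) :
  (forall n, measurable_fun [set: R] (f_ n)) -> measurable_fun [set: R] f ->
  rintegrable g -> (forall n t, `|f_ n t| <= g t) ->
  {ae mu, forall t, f_ n t @[n --> \oo] --> f t} ->
  (forall n, Rintegral mu [set: R] (f_ n) = 0) -> Rintegral mu [set: R] f = 0.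
Proof.
move=> mf_ mf ig fg fcvg f0.
have fg' : {ae mu, forall t n, [set: R] t -> (`|(f_ n t)%:E| <= (EFin \o g) t)%E}.
  by apply: aeW => t n _; rewrite lee_fin.
have [_ _] := @dominated_convergence _ _ _ mu [set: R] measurableT
  (fun n t => (f_ n t)%:E) (EFin \o f) (EFin \o g)
  (fun n => (measurable_EFinP _ _).2 (mf_ n)) ((measurable_EFinP _ _).2 mf)
  (ae_mono (fun t h _ => cvgn_EFin h) fcvg) ig
  fg'.
have fi n : rintegrable (f_ n) by apply: rintegrable_le ig => // t.
have -> : [sequence (\int[mu]_t (f_ n t)%:E)%E]_n = (fun=> 0%E) :> (nat -> \bar R).
  apply/funext => n /=; rewrite -[LHS]fineK; first by congr EFin; exact: f0.
  exact: (integrable_fin_num measurableT (fi n)).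
move=> cv; have : (\int[mu]_t (EFin \o f) t = 0)%E.
  by apply/esym/(cvg_unique _ (cvg_cst _) cv).
by rewrite /Rintegral => ->.
Qed.

(** The form in which vanishing coefficients pass to the limit: along Fourier partial sums on one
    circle, and along circles growing to the unit circle. *)
Lemma cintegral_dominated0 (f_ : nat -> R -> R[i]) (f : R -> R[i]) (g : R -> R) :
  (forall n, cmeasurable (f_ n)) -> cmeasurable f ->
  rintegrable g -> (forall n t, Normc.normc (f_ n t) <= g t) ->
  {ae mu, forall t, Normc.normc (f_ n t - f t) @[n --> \oo] --> 0} ->
  (forall n, cintegral (f_ n) = 0) -> cintegral f = 0.
Proof.
move=> mf_ mf ig fg fcvg f0.
have cvg_part (p : R[i] -> R) : (forall z w, p (z - w) = p z - p w) ->
    (forall z, `|p z| <= Normc.normc z) ->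
    {ae mu, forall t, p (f_ n t) @[n --> \oo] --> p (f t)}.
  move=> pB pN; apply: ae_mono fcvg => t ft; apply/subr_cvg0/norm_cvg0P.
  apply: (@squeeze_cvgr _ _ _ _ (fun=> 0) (fun n => Normc.normc (f_ n t - f t))) => //.
    by apply: nearW => n; rewrite normr_ge0 /= -pB.
  exact: cvg_cst.
apply: complex_ext.
  apply: (@Rintegral_dominated0 (fun n t => complex.Re (f_ n t)) _ g) => //.
  - by move=> n; have [] := mf_ n.
  - by case: mf.
  - by move=> n t; exact: le_trans (norm_Re_le _) (fg n t).
  - by apply: cvg_part => [z w|z]; [exact: cReB|exact: norm_Re_le].
  - by move=> n; have [] : cintegral (f_ n) = 0 := f0 n.
apply: (@Rintegral_dominated0 (fun n t => complex.Im (f_ n t)) _ g) => //.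
- by move=> n; have [] := mf_ n.
- by case: mf.
- by move=> n t; exact: le_trans (norm_Im_le _) (fg n t).
- by apply: cvg_part => [z w|z]; [exact: cImB|exact: norm_Im_le].
- by move=> n; have [] : cintegral (f_ n) = 0 := f0 n.
Qed.

Lemma Rintegral_circle (f : R -> R) : continuous f ->
  Rintegral mu [set: R] f = (2 * pi)^-1 * itv_int f 0 (2 * pi).
Proof.
move=> cf; have mf := continuous_measurable_fun cf; set T : R := 2 * pi.
have fi : lebesgue_measure.-integrable `[0, T] (EFin \o f).
  by apply: itv_integrable => x _; exact: cf.
have part (k : R -> \bar R) : measurable_fun [set: R] k -> (forall t, 0 <= k t)%E ->
    (\int[mu]_t k t = T^-1%:E * \int[lebesgue_measure]_(t in `[0%R, T]) k t)%E.
  by move=> mk k0; rewrite integral_uniform ?subr0.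
rewrite /Rintegral integralE !part //; last 2 first.
- by apply: measurable_funeneg; exact/measurable_EFinP.
- by apply: measurable_funepos; exact/measurable_EFinP.
have mI : measurable (`[0, T]%classic : set (measurableTypeR R)).
  exact: measurable_itv.
have p1 := integrable_pos_fin_num mI fi.
have p2 := integrable_neg_fin_num mI fi.
rewrite /itv_int /Rintegral [in RHS]integralE.
by rewrite -(fineK p1) -(fineK p2) -!EFinM -!EFinB /= mulrBr.
Qed.

End DominatedConvergence.

(** * Fourier coefficients on concentric circles *)

Section CircleCoefficients.
Context {R : realType}.
Notation mu := (circle_prob R).
Implicit Types (u : R[i] -> R[i]) (n : int) (s t M : R).

Definition log_circle u n s t : R[i] :=
  u (cexp (s +i* t)) * cexp (n%:~R * (s +i* t)).

(** The exponential is not conjugated: up to the factor exp(n s) this is the Fourier coefficient of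
    index -n on the circle of radius exp s. Positive n are thus the ones to be killed. *)
Definition circle_coef u n s := cintegral (log_circle u n s).

Lemma mul_intr_complex n (s t : R) : n%:~R * (s +i* t) = (n%:~R * s) +i* (n%:~R * t).
Proof.
rewrite -(rmorph_int (real_complex R)).
by apply: complex_ext; rewrite ?Re_realM ?Im_realM.
Qed.

Lemma log_circleE u n s t : log_circle u n s t =
  (expR (n%:~R * s))%:C * (u (cexp (s +i* t)) * expi (n%:~R * t)).
Proof. by rewrite /log_circle mul_intr_complex /cexp /=; ring. Qed.

Lemma log_circle_continuous u n s : analytic_disc u -> s < 0 ->
  continuous (fun t => complex.Re (log_circle u n s t)) /\
  continuous (fun t => complex.Im (log_circle u n s t)).
Proof.
move=> au s0.
have h t : exists c, has_cderiv (fun w => u (cexp w) * cexp (n%:~R * w)) (s +i* t) c.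
  exact: log_coordinate_cderiv.
by split=> t; have [c /has_cderiv_affine_approx[h1 h2 _]] := h t;
  [exact: affine_approx_conty h1|exact: affine_approx_conty h2].
Qed.

Lemma log_circle_measurable u n s : analytic_disc u -> s < 0 ->
  cmeasurable (log_circle u n s).
Proof.
move=> au s0; have [c1 c2] := log_circle_continuous n au s0.
by split; exact: continuous_measurable_fun.
Qed.

Lemma expi_int_period n t : expi (n%:~R * (t + 2 * pi)) = expi (n%:~R * t) :> R[i].
Proof.
have period (k : nat) x : expi (k%:R * (x + 2 * pi)) = expi (k%:R * x) :> R[i].
  elim: k => [|k IH]; first by rewrite !mul0r.
  have mulS (y : R) : k.+1%:R * y = k%:R * y + y by rewrite -natr1 mulrDl mul1r.
  by rewrite !mulS expiD IH expi_2pi -expiD.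
case: n => k; first exact: period.
by rewrite NegzE mulrNz -[k.+1%:Z%:~R]/(k.+1%:R) !mulNr !expiN period.
Qed.

Lemma circle_coef_const u n s1 s2 : analytic_disc u -> s1 <= s2 -> s2 < 0 ->
  circle_coef u n s1 = circle_coef u n s2.
Proof.
move=> au s12 s20; have s10 := le_lt_trans s12 s20.
have [c1 c2] := log_circle_continuous n au s10.
have [c3 c4] := log_circle_continuous n au s20.
have T0 : (0 : R) <= 2 * pi by rewrite mulr_ge0// pi_ge0.
have [|s t|e1 e2] := @cauchy_periodic R (fun w => u (cexp w) * cexp (n%:~R * w))
  s1 s2 (2 * pi) s12 T0.
- move=> s t; rewrite in_itv /= => /andP[_ ss].
  by apply: log_coordinate_cderiv => //; exact: le_lt_trans s20.
- rewrite !mul_intr_complex /cexp /= expi_2pi; congr (_ * (_ * _)).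
  exact: expi_int_period.
rewrite /circle_coef /cintegral !Rintegral_circle//.
by congr (_ * _ +i* (_ * _)).
Qed.

Lemma circle_coef_bound u n s M : analytic_disc u ->
  (forall z, `|z| < 1 -> Normc.normc (u z) <= M) -> s < 0 ->
  Normc.normc (circle_coef u n s) <= 2 * M * expR (n%:~R * s).
Proof.
move=> au uM s0.
have bnd t : Normc.normc (log_circle u n s t) <= M * expR (n%:~R * s).
  rewrite log_circleE 2!Normc.normcM normc_expi mulr1 normc_real.
  rewrite ger0_norm ?expR_ge0// mulrC ler_wpM2r ?expR_ge0//.
  by apply: uM; rewrite normc_norm ltcR normc_cexp expR_lt1.
have mg := log_circle_measurable n au s0.
have ig : cintegrable (log_circle u n s).
  exact: (cintegrable_le mg bnd (rintegrable_cst _)).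
apply: (le_trans (normc_cintegral ig)); rewrite -mulrA ler_wpM2l//.
apply: (@le_trans _ _ (Rintegral mu [set: R] (fun=> M * expR (n%:~R * s)))).
  apply: le_Rintegral => //; first exact: (cintegrable_normc ig).
  exact: rintegrable_cst.
rewrite Rintegral_cst//.
by have /= -> := @probability_setT _ _ _ mu; rewrite mulr1.
Qed.

(** The coefficient does not depend on s, while its bound 2 M exp(n s) tends to 0 as s goes to
    -infinity. *)
Lemma circle_coef_eq0 u n s M : analytic_disc u ->
  (forall z, `|z| < 1 -> Normc.normc (u z) <= M) -> s < 0 -> 0 < n ->
  circle_coef u n s = 0.
Proof.
move=> au uM s0 n0; apply: Normc.eq0_normc; apply/eqP.
have M0 : 0 <= M.
  by apply: le_trans (uM 0 _); rewrite ?normc_ge0// normr0.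
set x := Normc.normc _; have x0 : 0 <= x by exact: normc_ge0.
apply: contraT => xne; have {xne x0} x0 : 0 < x by rewrite lt_neqAle eq_sym xne.
(* Chosen so that a < 1, hence ln a < 0, and 2 M a < x: on the circle of radius at most a the bound
   contradicts |coefficient| = x. *)
pose a := x / (x + 2 * M + 1).
have D0 : 0 < x + 2 * M + 1 by rewrite ltr_wpDl// addr_ge0 ?(ltW x0)// mulr_ge0.
have a0 : 0 < a by rewrite divr_gt0.
have a1 : a < 1 by rewrite ltr_pdivrMr// mul1r; nra.
pose s' := Num.min s (ln a).
have s'0 : s' < 0 by rewrite gt_min s0.
have := circle_coef_bound n au uM s'0.
rewrite (@circle_coef_const u n s' s)// ?ge_min ?lexx// -/x.
have : expR (n%:~R * s') <= a.
  apply: (@le_trans _ _ (expR s')).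
    have n1 : (1 : R) <= n%:~R by rewrite -[leLHS]/(1%:~R) ler_int -gtz0_ge1.
    by rewrite ler_expR -[leRHS]mul1r ler_wnM2r// ltW.
  by rewrite -[leRHS](@lnK _ a) ?posrE// ler_expR ge_min lexx orbT.
have -> : a = x * (x + 2 * M + 1)^-1 by [].
move=> h1 h2; suff : 2 * M * (x * (x + 2 * M + 1)^-1) < x.
  by move/lt_geF/negP; case; apply: (le_trans h2); rewrite ler_wpM2l// mulr_ge0.
rewrite mulrCA gtr_pMr// ltr_pdivrMr// mul1r; lra.
Qed.

Lemma expi_measurable n : cmeasurable (fun t => expi (n%:~R * t) : R[i]).
Proof.
by split; [apply: (@measurableT_comp _ _ _ _ _ _ (@cos R))|
  apply: (@measurableT_comp _ _ _ _ _ _ (@sin R))];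
  [apply: continuous_measurable_fun; exact: continuous_cos|exact: mulrl_measurable|
   apply: continuous_measurable_fun; exact: continuous_sin|exact: mulrl_measurable].
Qed.

Lemma expi_cintegrable n : cintegrable (fun t => expi (n%:~R * t) : R[i]).
Proof.
apply: (@cintegrable_le _ _ (fun=> 1)); last exact: rintegrable_cst.
  exact: expi_measurable.
by move=> t; rewrite normc_expi.
Qed.

Lemma log_circle_fun u n s : log_circle u n s = (fun t =>
  (expR (n%:~R * s))%:C * (u (cexp (s +i* t)) * expi (n%:~R * t))).
Proof. by apply/funext => t; rewrite log_circleE. Qed.

(** The constant function 1 is analytic and bounded, so its coefficients vanish for n > 0; no
    antiderivative is computed. Conjugation gives n < 0. *)
Lemma expi_orthogonal n : n != 0 -> cintegral (fun t => expi (n%:~R * t)) = 0 :> R[i].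
Proof.
have pos k : 0 < k -> cintegral (fun t => expi (k%:~R * t)) = 0 :> R[i].
  move=> k0; have a1 : analytic_disc (fun=> 1 : R[i]) by move=> z _; exact: derivable_cst.
  have lt0 : (-1 : R) < 0 by rewrite ltrN10.
  have := @circle_coef_eq0 _ k (-1) 1 a1 _ lt0 k0.
  rewrite Normc.normc1 => /(_ (fun _ _ => lexx 1)).
  rewrite /circle_coef log_circle_fun; under eq_fun do rewrite mul1r.
  rewrite cintegralZ; last exact: expi_cintegrable.
  move=> /eqP; rewrite mulf_eq0 => /orP[|/eqP//].
  by rewrite (inj_eq (@complexI R)) gt_eqF// expR_gt0.
move=> n0; have [np|] := ltP 0 n; first exact: pos.
rewrite le_eqVlt (negPf n0) /= => nn.
have Nn : 0 < - n by rewrite oppr_gt0.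
have -> : (fun t => expi (n%:~R * t) : R[i]) = (fun t => (expi ((- n)%:~R * t))^*).
  by apply/funext => t; rewrite -expiN mulrNz mulNr opprK.
by rewrite (cintegral_conj (expi_cintegrable _)) pos// rmorph0.
Qed.

End CircleCoefficients.

(** * Fourier series of analytic functions on smaller circles *)

Section Bessel.
Context {R : realType}.
Implicit Types (f g : R -> R[i]) (e : nat -> R -> R[i]).

(** Induction peels off one component at a time. The strengthened claim keeps the residual [g],
    whose coefficients from index K on are still those of f. *)
Lemma bessel_inequality e f : L2 f -> (forall k, L2 (e k)) ->
  (forall j k, inner (e j) (e k) = (j == k)%:R) ->
  forall K, \sum_(0 <= k < K) Normc.normc (inner f (e k)) ^+ 2 <= norm2 f ^+ 2.
Proof.
move=> Lf Le eo K.
suff [g [Lg _ <-]] : exists g, [/\ L2 g,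
    forall k, (K <= k)%N -> inner g (e k) = inner f (e k) &
    norm2 g ^+ 2 + \sum_(0 <= k < K) Normc.normc (inner f (e k)) ^+ 2 = norm2 f ^+ 2].
  by rewrite lerDr sqr_ge0.
elim: K => [|K [g [Lg gk gf]]]; first by exists f; rewrite big_geq// addr0.
pose c := inner f (e K); have Lce := L2Z c (Le K).
exists (g \- (c \*o e K)); split; first exact: L2B.
  move=> k Kk; rewrite innerBl// innerZl// gk ?(ltnW Kk)// eo.
  by rewrite (ltn_eqF Kk) mulr0 subr0.
rewrite norm2B_sqr// norm2Z// innerZr// gk// -/c mulrC (mulrC c^*) mulcJ cReC.
have -> : norm2 (e K) = 1.
  apply/eqP; rewrite -(@eqrXn2 _ 2) ?norm2_ge0 ?ler01// expr1n.
  by apply/eqP/(@complexI R); rewrite -innerff eo eqxx.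
by rewrite big_nat_recr//= -gf -/c mul1r; ring.
Qed.

Lemma bessel_cvg0 e f : L2 f -> (forall k, L2 (e k)) ->
  (forall j k, inner (e j) (e k) = (j == k)%:R) ->
  Normc.normc (inner f (e k)) @[k --> \oo] --> 0.
Proof.
move=> Lf Le eo.
have c2 : (fun k => Normc.normc (inner f (e k)) ^+ 2) @ \oo --> 0.
  apply: cvg_series_cvg_0; apply: nondecreasing_is_cvgn.
    by apply/nondecreasing_seqP => n; rewrite /series/= big_nat_recr//= lerDl sqr_ge0.
  exists (norm2 f ^+ 2) => _ [n _ <-]; exact: bessel_inequality.
have := cvg_comp _ _ c2 (@sqrt_continuous R 0); rewrite sqrtr0.
rewrite (_ : _ \o _ = (fun k => Normc.normc (inner f (e k))))//.
by apply/funext => k; rewrite /= sqrtr_sqr ger0_norm ?normc_ge0.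
Qed.

Lemma L2_expi (n : int) : L2 (fun t : R => expi (n%:~R * t)).
Proof.
apply: (@L2_bounded _ 1); first exact: expi_measurable.
by move=> t; rewrite normc_expi.
Qed.

Lemma expi_intD (m n : int) (t : R) :
  expi ((m + n)%:~R * t) = expi (m%:~R * t) * expi (n%:~R * t).
Proof. by rewrite rmorphD /= mulrDl expiD. Qed.

Lemma inner_expi (m n : int) :
  inner (fun t : R => expi (m%:~R * t)) (fun t => expi (n%:~R * t)) = (m == n)%:R.
Proof.
rewrite /inner; under eq_fun do rewrite -expiN -mulNr -mulrNz -expi_intD.
have [->|mn] := eqVneq m n; last by rewrite expi_orthogonal// subr_eq0.
rewrite subrr; under eq_fun do rewrite mul0r expi0.
exact: cintegral_cst.
Qed.

(** Riemann-Lebesgue for L^2 functions, with [sg] choosing the end of the frequency line. Signs are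
    reversed in [e] because the inner product conjugates. *)
Lemma coef_cvg0 (f : R -> R[i]) (sg : bool) : L2 f ->
  Normc.normc (cintegral (fun t => f t * expi ((if sg then k%:Z else - k%:Z)%:~R * t)))
    @[k --> \oo] --> 0.
Proof.
move=> Lf.
pose e (k : nat) := fun t : R => expi ((if sg then - k%:Z else k%:Z)%:~R * t).
have := @bessel_cvg0 e f Lf (fun k => L2_expi _).
have -> : (fun k => Normc.normc (inner f (e k))) = (fun k => Normc.normc
    (cintegral (fun t => f t * expi ((if sg then k%:Z else - k%:Z)%:~R * t)))).
  apply/funext => k; congr (Normc.normc (cintegral _)); apply/funext => t.
  by rewrite /e -expiN -mulNr -mulrNz; case: sg {e} => //; rewrite opprK.
apply => j k; rewrite /e inner_expi; case: sg {e} => //.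
by rewrite eqr_opp.
Qed.

(** The formula 1 / f = conj f / |f|^2 persists at the zeros of f, both sides being 0 there by
    convention. *)
Lemma cmeasurableV (f : R -> R[i]) : cmeasurable f -> cmeasurable (fun t => (f t)^-1).
Proof.
move=> mf; pose k t := (Normc.normc (f t) ^+ 2)^-1.
have -> : (fun t => (f t)^-1) = (fun t => (k t)%:C * (f t)^*).
  apply/funext => t; rewrite /k; have [->|f0] := eqVneq (f t) 0.
    by rewrite invr0 rmorph0 mulr0.
  apply: (mulfI f0); rewrite divff// mulrCA mulcJ -rmorphM mulVf ?rmorph1//.
  by rewrite sqrf_eq0; apply: contra f0 => /eqP/Normc.eq0_normc ->.
have mk : measurable_fun [set: R] k.
  rewrite (_ : k = (fun t => (Normc.normc (f t) ^+ 2) `^ (-1))).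
    apply: (@measurableT_comp _ _ _ _ _ _ (fun x : R => x `^ (-1))).
      exact: measurable_powR.
    exact: measurable_normc_sqr.
  by apply/funext => t; rewrite powR_inv1// sqr_ge0.
apply: cmeasurableM; last exact: cmeasurable_conj.
by split => //=; exact: measurable_cst.
Qed.

End Bessel.

(** * Pointwise Fourier expansion on a circle inside the disc *)

Section Chernoff.
Context {R : realType}.
Notation mu := (circle_prob R).
Variables (u : R[i] -> R[i]) (M s : R).
Hypotheses (au : analytic_disc u) (uM : forall z, `|z| < 1 -> Normc.normc (u z) <= M).
Hypothesis s0 : s < 0.

Let v t := u (cexp (s +i* t)).
Let c (n : int) := cintegral (fun t => v t * expi (n%:~R * t)).

Let disc t : `|cexp (s +i* t)| < 1.
Proof. by rewrite normc_norm ltcR normc_cexp expR_lt1. Qed.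

Lemma circle_bounded t : Normc.normc (u (cexp (s +i* t))) <= M.
Proof. exact: uM. Qed.

Lemma circle_measurable : cmeasurable (fun t => u (cexp (s +i* t))).
Proof.
have := log_circle_measurable 0 au s0; congr cmeasurable; apply/funext => t.
by rewrite log_circleE !mul0r expR0 expi0 mulr1 mul1r.
Qed.

Let Lv : L2 v.
Proof. by apply: (@L2_bounded _ M); [exact: circle_measurable|exact: circle_bounded]. Qed.

Let L2_mul_expi f (n : int) : L2 f -> L2 (fun t : R => f t * expi (n%:~R * t)).
Proof.
move=> Lf; rewrite (_ : (fun t => _) = (fun t => expi (n%:~R * t)) \* f).
  apply: (@L2_mul_bounded _ 1) => //; first exact: expi_measurable.
  by move=> t; rewrite normc_expi.
by apply/funext => t; rewrite mulrC.
Qed.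

Let circle_coefE n : circle_coef u n s = (expR (n%:~R * s))%:C * c n.
Proof.
rewrite /circle_coef log_circle_fun cintegralZ//.
exact: L2_cintegrable (L2_mul_expi n Lv).
Qed.

Let expR_neq0 (x : R) : (expR x)%:C != 0 :> R[i].
Proof. by rewrite (inj_eq (@complexI R)) gt_eqF// expR_gt0. Qed.

Let c_pos (n : int) : 0 < n -> c n = 0.
Proof.
move=> n0; have /eqP := circle_coef_eq0 au uM s0 n0.
by rewrite circle_coefE mulf_eq0 (negPf (expR_neq0 _)) => /eqP.
Qed.

(** The coefficient on circle s equals that on circle s / 2, which is at most 2 M exp(-k s / 2);
    removing the factor exp(-k s) leaves geometric decay. *)
Let c_neg (k : nat) : Normc.normc (c (- k%:Z)) <= 2 * M * expR (s / 2) ^+ k.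
Proof.
have s2 : s / 2 < 0 by move: s0; lra.
have := circle_coef_bound (- k%:Z) au uM s2.
rewrite -(@circle_coef_const _ u (- k%:Z) s (s / 2)) ?circle_coefE//; last by move: s0; lra.
rewrite Normc.normcM normc_real ger0_norm ?expR_ge0// mulrC -ler_pdivlMr ?expR_gt0//.
move/le_trans; apply; rewrite -[leLHS]mulrA -expRN -expRD -expRM_natl.
rewrite (_ : (- k%:Z)%:~R * (s / 2) - (- k%:Z)%:~R * s = k%:R * (s / 2))//.
by rewrite mulrNz -[k%:Z%:~R]/(k%:R); lra.
Qed.

Section Quotient.
Variable t0 : R.

Let q t := (v t - v t0) / (cexp (s +i* t) - cexp (s +i* t0)).
Let qh (n : int) := cintegral (fun t => q t * expi (n%:~R * t)).

(** Also true when the denominator vanishes: the two points of the circle then coincide, so v t = v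
    t0 and [q t] is 0. *)
Let qE t : v t = v t0 + (cexp (s +i* t) - cexp (s +i* t0)) * q t.
Proof.
rewrite /q mulrCA; have [/eqP|d0] := eqVneq (cexp (s +i* t) - cexp (s +i* t0)) 0.
  by rewrite subr_eq0 => /eqP e; rewrite /v e subrr mul0r addr0.
by rewrite divff// mulr1 addrC subrK.
Qed.

(** The quotient is bounded: near the base point by differentiability of u, elsewhere by 2 M / d.
    Nearness is measured between points of the disc, so angles differing by 2 pi cause no
    trouble. *)
Let Lq : L2 q.
Proof.
have [k uk] := derivable_has_cderiv (au (disc t0)).
have [d d0 dP] := uk 1 ltr01.
have M0 : 0 <= M by exact: le_trans (normc_ge0 _) (circle_bounded t0).
have kn := normc_ge0 k.
have mz : cmeasurable (fun t => cexp (s +i* t)).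
  rewrite /cexp /=; apply: cmeasurableM; first exact: cmeasurable_cst.
  by have := @expi_measurable R 1; under eq_fun do rewrite mul1r.
apply: (@L2_bounded _ (Normc.normc k + 1 + 2 * M / d)).
  apply: cmeasurableM.
    by apply: cmeasurableB; [exact: circle_measurable|exact: cmeasurable_cst].
  by apply: cmeasurableV; apply: cmeasurableB => //; exact: cmeasurable_cst.
move=> t; rewrite /q; set w := cexp (s +i* t); set z := cexp (s +i* t0).
have Md : 0 <= 2 * M / d by rewrite divr_ge0 ?mulr_ge0// ltW.
have [->|wz] := eqVneq (w - z) 0.
  rewrite invr0 mulr0 (normc_real 0) normr0; lra.
have n0 : 0 < Normc.normc (w - z).
  rewrite lt_neqAle normc_ge0 andbT eq_sym; apply: contra wz => /eqP/Normc.eq0_normc ->.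
  by [].
rewrite Normc.normcM Normc.normcV ler_pdivrMr//.
have [near|far] := ltP (Normc.normc (w - z)) d.
  have -> : v t - v t0 = (u w - u z - k * (w - z)) + k * (w - z) by rewrite /v; ring.
  apply: (le_trans (le_normcD _ _)); rewrite Normc.normcM.
  have := dP w near; rewrite mul1r; nra.
have : Normc.normc (v t - v t0) <= 2 * M.
  apply: (le_trans (le_normcD _ _)); rewrite normcN.
  have := circle_bounded t; have := circle_bounded t0; rewrite /v; lra.
have : 2 * M <= 2 * M / d * Normc.normc (w - z).
  by rewrite -mulrA ler_peMr ?mulr_ge0// mulrC ler_pdivlMr// mul1r.
by nra.
Qed.

(** Multiplication by [cexp (s +i* t)] shifts the index of a coefficient, so [qE] becomes a
    first-order recurrence. *)
Let qh_rec n : c n = v t0 * (n == 0)%:R +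
  (expR s)%:C * (qh (n + 1) - expi t0 * qh n).
Proof.
have i1 := L2_cintegrable (L2_mul_expi n Lq).
have i2 := L2_cintegrable (L2_mul_expi (n + 1) Lq).
have iE := @expi_cintegrable R n.
have -> : c n = cintegral (fun t => v t0 * expi (n%:~R * t) +
    (expR s)%:C * (q t * expi ((n + 1)%:~R * t) +
     (- expi t0) * (q t * expi (n%:~R * t)))).
  congr cintegral; apply/funext => t; rewrite {1}qE expi_intD mul1r /cexp /=; ring.
have i3 : cintegrable (fun t => (- expi t0) * (q t * expi (n%:~R * t))).
  exact: cintegrableZ.
rewrite cintegralD; [|exact: cintegrableZ|exact/cintegrableZ/cintegrableD].
rewrite !cintegralZ//; last exact: cintegrableD.
rewrite cintegralD// cintegralZ// mulNr; congr (_ * _ + _).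
have := @inner_expi R n 0; rewrite /inner.
under eq_fun do rewrite mul0r expi0 conjC1 mulr1.
exact.
Qed.

(** For positive indices [c] vanishes, so the recurrence keeps the modulus of [qh] constant; that
    modulus also tends to 0. *)
Let qh1 : qh 1 = 0.
Proof.
have qS (k : nat) : Normc.normc (qh k.+1%:Z) = Normc.normc (qh 1).
  elim: k => // k <-; have := qh_rec k.+1%:Z; rewrite c_pos// mulr0 add0r.
  move/esym/eqP; rewrite mulf_eq0 (negPf (expR_neq0 _)) /= subr_eq0 => /eqP.
  by rewrite -PoszD addn1 => ->; rewrite Normc.normcM normc_expi mul1r.
apply: Normc.eq0_normc; have h := @coef_cvg0 R q true Lq.
have : Normc.normc (qh k.+1%:Z) @[k --> \oo] --> 0.
  by have := h; rewrite -(cvg_shiftS (fun k : nat => Normc.normc (qh k%:Z))); exact.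
under eq_fun do rewrite qS.
by move=> /(cvg_unique _ (cvg_cst _)) ->.
Qed.

(** The recurrence at -k, multiplied by exp(i k t0), telescopes. [qh1] removes one end, and the
    other tends to 0 with N. *)
Let partial_sum (N : nat) : \sum_(0 <= k < N.+1) c (- k%:Z) * expi (k%:R * t0) =
  v t0 - (expR s)%:C * expi (N.+1%:R * t0) * qh (- N%:Z).
Proof.
elim: N => [|N IH].
  rewrite big_nat1 mul0r expi0 mulr1 qh_rec oppr0 eqxx mulr1 add0r qh1 mul1r; ring.
rewrite big_nat_recr//= IH qh_rec oppr_eq0 /= mulr0 add0r.
have -> : - N.+1%:Z + 1 = - N%:Z by rewrite -addn1 PoszD opprD subrK.
have -> : expi (N.+2%:R * t0) = expi (N.+1%:R * t0) * expi t0 :> R[i].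
  by rewrite -[N.+2%:R]natr1 mulrDl mul1r expiD.
ring.
Qed.

(* Chernoff's proof of pointwise convergence of Fourier series. *)
Lemma circle_fourier_cvg :
  Normc.normc (\sum_(0 <= k < N.+1) c (- k%:Z) * expi (k%:R * t0) - v t0)
    @[N --> \oo] --> 0.
Proof.
have -> : (fun N => Normc.normc (\sum_(0 <= k < N.+1) c (- k%:Z) * expi (k%:R * t0)
    - v t0)) = (fun N : nat => expR s * Normc.normc (qh (- N%:Z))).
  apply/funext => N; rewrite partial_sum addrAC subrr add0r normcN.
  by rewrite !Normc.normcM normc_expi mulr1 normc_real ger0_norm ?expR_ge0.
rewrite -[X in _ --> X](mulr0 (expR s)); apply: cvgMr.
exact: (@coef_cvg0 R q false Lq).
Qed.

End Quotient.

(** Replacing u by its partial sums leaves finitely many coefficients of h, all of negative index;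
    dominated convergence removes the truncation. *)
Lemma circle_mul_coef0 (h : R -> R[i]) (n : int) :
  L2 h -> (forall m : int, m < 0 -> fourier h m = 0) -> 0 < n ->
  cintegral (fun t => u (cexp (s +i* t)) * h t * expi (n%:~R * t)) = 0.
Proof.
move=> Lh h0 n0; set rho := expR (s / 2).
have M0 : 0 <= M by exact: le_trans (normc_ge0 _) (circle_bounded 0).
have rho0 : 0 <= rho by exact: expR_ge0.
have rho1 : rho < 1 by rewrite expR_lt1; move: s0; lra.
pose S (N : nat) t := \sum_(0 <= k < N.+1) c (- k%:Z) * expi (k%:R * t).
(* The geometric decay of [c_neg] bounds all partial sums uniformly, which provides the integrable
   majorant. *)
have SB N t : Normc.normc (S N t) <= 2 * M / (1 - rho).
  have : Normc.normc (S N t) <= 2 * M * ((1 - rho ^+ N.+1) / (1 - rho)).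
    have rn : 1 - rho != 0 by rewrite subr_eq0 gt_eqF.
    elim: N => [|N IH].
      rewrite /S big_nat1 Normc.normcM normc_expi mulr1 expr1 divff// mulr1.
    rewrite /S big_nat_recr//=; apply: (le_trans (le_normcD _ _)).
    rewrite Normc.normcM normc_expi mulr1.
    apply: (le_trans (lerD IH (c_neg _))); rewrite -/rho -mulrDr ler_wpM2l ?mulr_ge0//.
    by rewrite le_eqVlt [rho ^+ N.+2]exprS; apply/orP; left; apply/eqP; field.
  move=> /le_trans; apply; rewrite ler_wpM2l ?mulr_ge0//.
  rewrite ler_pdivrMr ?subr_gt0// mulVf; last by rewrite gt_eqF// subr_gt0.
  by rewrite gerBl exprn_ge0.
have mS N : cmeasurable (S N).
  elim: N => [|N IH].
    rewrite /S; under eq_fun do rewrite big_nat1.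
    apply: cmeasurableM; first exact: cmeasurable_cst.
    exact: (@expi_measurable R 0%:Z).
  rewrite /S; under eq_fun do rewrite big_nat_recr//=.
  apply: cmeasurableD => //; apply: cmeasurableM; first exact: cmeasurable_cst.
  exact: (@expi_measurable R N.+1%:Z).
have mh := L2_measurable Lh.
apply: (@cintegral_dominated0 _ (fun N t => S N t * h t * expi (n%:~R * t)) _
  (fun t => 2 * M / (1 - rho) * Normc.normc (h t))).
- move=> N; apply: cmeasurableM; last exact: expi_measurable.
  exact: cmeasurableM.
- apply: cmeasurableM; last exact: expi_measurable.
  by apply: cmeasurableM => //; exact: circle_measurable.
- by apply: rintegrableZ; apply: cintegrable_normc; exact: L2_cintegrable.
- move=> N t; rewrite !Normc.normcM normc_expi mulr1.
  by rewrite ler_wpM2r ?normc_ge0.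
- apply: aeW => t.
  have -> : (fun N => Normc.normc (S N t * h t * expi (n%:~R * t) -
      u (cexp (s +i* t)) * h t * expi (n%:~R * t))) =
      (fun N => Normc.normc (S N t - v t) * Normc.normc (h t)).
    apply/funext => N; rewrite -!mulrBl !Normc.normcM normc_expi mulr1//.
  rewrite -[X in _ --> X](mul0r (Normc.normc (h t))); apply: cvgMl.
  exact: circle_fourier_cvg.
(* This is a multiple of the coefficient of h of index -(k + n), which is negative. *)
have term (k : nat) : cintegral (fun t => c (- k%:Z) * (h t * expi ((k%:Z + n)%:~R * t))) = 0.
  rewrite cintegralZ; last exact: L2_cintegrable (L2_mul_expi _ Lh).
  have := h0 (- (k%:Z + n)); rewrite oppr_lt0 ltr_wpDl// => /(_ isT).
  rewrite /fourier; under eq_fun do rewrite -expiN -mulNr -mulrNz opprK.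
  by move=> ->; rewrite mulr0.
have termE k t : c (- k%:Z) * expi (k%:R * t) * h t * expi (n%:~R * t) =
    c (- k%:Z) * (h t * expi ((k%:Z + n)%:~R * t)).
  by rewrite expi_intD -[k%:Z%:~R]/(k%:R); ring.
have iterm (k : nat) : cintegrable (fun t => c (- k%:Z) * (h t * expi ((k%:Z + n)%:~R * t))).
  by apply: cintegrableZ; exact: L2_cintegrable (L2_mul_expi _ Lh).
have main N : cintegrable (fun t => S N t * h t * expi (n%:~R * t)) /\
    cintegral (fun t => S N t * h t * expi (n%:~R * t)) = 0.
  elim: N => [|N [IHi IH]].
    rewrite /S; under eq_fun do rewrite big_nat1 termE.
    by split; [exact: iterm|exact: term].
  rewrite /S; under eq_fun do rewrite big_nat_recr//= !mulrDl termE.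
  split; first exact: cintegrableD.
  by rewrite cintegralD// term addr0.
by move=> N; exact: (main N).2.
Qed.

End Chernoff.

(** * The minimum modulus *)

Section OrthogonalProjection.
Context {R : realType}.
Notation mu := (circle_prob R).
Implicit Types (f g h w : R -> R[i]) (z : R[i]) (M : set (R -> R[i])).

Definition is_proj M f g := M g /\ forall h, M h -> inner (f \- g) h = 0.

Lemma orthoprojP M f : (exists g, is_proj M f g) -> is_proj M f (orthoproj M f).
Proof. by move=> ex; apply: (@xgetPex _ _ [set g | is_proj M f g]). Qed.

(** A true equality of functions: both arguments define the same set of candidates, from which
    [xget] picks the same element. *)
Lemma ae_eq_orthoproj M f1 f2 : {ae mu, forall t, f1 t = f2 t} ->
  orthoproj M f1 = orthoproj M f2.
Proof.
move=> f12; congr xget; apply/seteqP; split=> g [Mg gP]; split=> // h Mh;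
  rewrite -(gP h Mh); apply: ae_eq_inner; try exact: aeW;
  by apply: ae_mono f12 => t /= ->.
Qed.

Lemma subspaceB M f g : linear_subspace M -> M f -> M g -> M (f \- g).
Proof. by move=> [_ _ MD MZ] Mf Mg; rewrite subf_addZ; apply: MD => //; exact: MZ. Qed.

Lemma norm2_eq0P f : inner f f = 0 -> norm2 f = 0.
Proof.
rewrite innerff => /(@complexI R)/eqP; rewrite sqrf_eq0 => /eqP; exact.
Qed.

Lemma is_proj_unique M f g1 g2 : linear_subspace M -> L2 f ->
  is_proj M f g1 -> is_proj M f g2 -> norm2 (g1 \- g2) = 0.
Proof.
move=> sM Lf [M1 p1] [M2 p2]; have [ML _ _ _] := sM.
have L1 := ML _ M1; have L2' := ML _ M2; have M12 := subspaceB sM M1 M2.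
have L12 := L2B L1 L2'; apply: norm2_eq0P; rewrite {1}(_ : g1 \- g2 = (f \- g2) \- (f \- g1)).
  by rewrite innerBl ?p1 ?p2 ?subrr//; exact: L2B.
by apply/funext => t /=; ring.
Qed.

Lemma is_proj_norm_eq M f g1 g2 : linear_subspace M -> L2 f ->
  is_proj M f g1 -> is_proj M f g2 -> norm2 (f \- g1) = norm2 (f \- g2).
Proof.
move=> sM Lf p1 p2; have [ML _ _ _] := sM.
have L1 := ML _ p1.1; have L2' := ML _ p2.1.
apply: norm2_eq_of_sub0; [exact: L2B|exact: L2B|].
rewrite -(is_proj_unique sM Lf p2 p1); congr norm2.
by apply/funext => t /=; rewrite opprB addrC addrA subrK.
Qed.

Lemma is_proj_pythagoras M f g : linear_subspace M -> L2 f -> is_proj M f g ->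
  norm2 f ^+ 2 = norm2 (f \- g) ^+ 2 + norm2 g ^+ 2.
Proof.
move=> [ML _ _ _] Lf [Mg gP]; have Lg := ML _ Mg.
rewrite -pythagoras ?gP//; last exact: L2B.
by congr (norm2 _ ^+ 2); apply/funext => t /=; rewrite subrK.
Qed.

Lemma is_projZ M f g z : linear_subspace M -> L2 f -> is_proj M f g ->
  is_proj M (z \*o f) (z \*o g).
Proof.
move=> [ML _ _ MZ] Lf [Mg gP]; have Lg := ML _ Mg.
split=> [|h Mh]; first exact: MZ.
rewrite (_ : _ \- _ = z \*o (f \- g)).
  by rewrite innerZl ?gP ?mulr0//; [exact: L2B|exact: ML].
by apply/funext => t /=; rewrite mulrBr.
Qed.

Lemma fourierE f n : fourier f n = inner f (fun t => expi (n%:~R * t)).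
Proof. by []. Qed.

Lemma H2_subspace : linear_subspace (@H2 R).
Proof.
split=> [f []//||f g [Lf f0] [Lg g0]|z f [Lf f0]].
- split=> [|n _]; first exact: L2_cst.
  by rewrite /fourier; under eq_fun do rewrite mul0r; rewrite cintegral_cst.
- split=> [|n n0]; first exact: L2D.
  by rewrite fourierE innerDl// -?fourierE ?f0 ?g0 ?addr0//; exact: L2_expi.
- split=> [|n n0]; first exact: L2Z.
  by rewrite fourierE innerZl// -?fourierE ?f0 ?mulr0//; exact: L2_expi.
Qed.

Lemma H2_closed : L2_closed (@H2 R).
Proof.
move=> h g Hh Lg hg; split=> // n n0; apply: Normc.eq0_normc; apply/eqP.
have Le := @L2_expi R n; have Lh k := (Hh k).1.
have bnd k : Normc.normc (fourier g n) <=
    norm2 (g \- h k) * norm2 (fun t : R => expi (n%:~R * t)).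
  have -> : fourier g n = inner (g \- h k) (fun t : R => expi (n%:~R * t)).
    by rewrite innerBl// -!fourierE (Hh k).2// subr0.
  by apply: normc_inner_le => //; exact: L2B.
rewrite eq_le normc_ge0 andbT.
have lim0 : norm2 (g \- h k) * norm2 (fun t : R => expi (n%:~R * t))
    @[k --> \oo] --> 0.
  by rewrite -[X in _ --> X](mul0r (norm2 (fun t : R => expi (n%:~R * t))));
    exact: cvgMl.
apply: (ler_cvg_to (cvg_cst (Normc.normc (fourier g n))) lim0).
exact: nearW.
Qed.

Lemma H2_proj f : L2 f -> is_proj H2 f (orthoproj H2 f).
Proof.
move=> Lf; apply: orthoprojP.
by have [g Hg gP] := projection_exists H2_subspace H2_closed Lf; exists g.
Qed.

Lemma H2_one : H2 (fun _ : R => 1 : R[i]).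
Proof.
split=> [|n n0]; first exact: L2_cst.
have := @inner_expi R 0 n; rewrite /inner /fourier.
under eq_fun do rewrite mul0r expi0.
by rewrite eq_sym lt_eqF.
Qed.

End OrthogonalProjection.

Section UnimodularMultiplication.
Context {R : realType}.
Variable a : R -> R[i].
Hypotheses (ma : cmeasurable a) (a1 : forall t, Normc.normc (a t) = 1).
Implicit Types (f g : R -> R[i]).

Lemma unimodular_L2 f : L2 f -> L2 (a \* f).
Proof. by apply: (@L2_mul_bounded _ 1) => // t; rewrite a1. Qed.

Lemma unimodular_conj_L2 f : L2 f -> L2 (conjf a \* f).
Proof.
apply: (@L2_mul_bounded _ 1); first exact: cmeasurable_conj.
by move=> t; rewrite /conjf conjE normc_conj a1.
Qed.

Lemma unimodular_mulcJ t : a t * (a t)^* = 1.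
Proof. by rewrite mulcJ a1 expr1n. Qed.

Lemma inner_mull f g : inner (a \* f) g = inner f (conjf a \* g).
Proof.
congr cintegral; apply/funext => t /=.
by rewrite /conjf conjE rmorphM /= conjCK; ring.
Qed.

Lemma inner_mulr f g : inner f (a \* g) = inner (conjf a \* f) g.
Proof.
by congr cintegral; apply/funext => t /=; rewrite /conjf conjE rmorphM /=; ring.
Qed.

Lemma norm2_unimodular f : norm2 (a \* f) = norm2 f.
Proof.
congr (Num.sqrt (fine _)); apply: eq_integral => t _ /=.
by rewrite Normc.normcM a1 mul1r.
Qed.

Lemma norm2_unimodular_conj f : norm2 (conjf a \* f) = norm2 f.
Proof.
congr (Num.sqrt (fine _)); apply: eq_integral => t _ /=.
by rewrite /conjf conjE Normc.normcM normc_conj a1 mul1r.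
Qed.

End UnimodularMultiplication.

(** * From pointwise estimates to suprema *)

Section SupremumFormulas.
Context {R : realType} {V : Type}.
Variables (K : set V) (nrm F G H : V -> R) (m : R) (o : V).
Hypotheses (Ko : K o) (nrm_o : nrm o <= 1).
Hypothesis F_ge0 : forall f, 0 <= F f.
Hypothesis G_ge0 : forall f, K f -> 0 <= G f.
Hypothesis H_ge0 : forall f, K f -> 0 <= H f.
Hypothesis F_sqr : forall f, K f -> F f ^+ 2 = G f ^+ 2 + H f ^+ 2.
Hypothesis F_le : forall f, K f -> F f <= nrm f.
Hypothesis m_ge0 : 0 <= m.
Hypothesis m_lower : forall C, 0 <= C -> (forall f, K f -> nrm f = 1 -> F f <= C) ->
  Num.sqrt (1 - C ^+ 2) <= m.
Hypothesis m_upper : forall f, K f -> nrm f <= 1 -> m ^+ 2 <= 1 - F f ^+ 2.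

Let opn (E : V -> R) := sup [set E f | f in [set f | K f /\ nrm f <= 1]].

Let opn_has_sup E : (forall f, K f -> E f <= F f) ->
  has_sup [set E f | f in [set f | K f /\ nrm f <= 1]].
Proof.
move=> EF; split; first by exists (E o), o.
exists 1 => _ [f [Kf f1] <-]; apply: (le_trans (EF f Kf)).
exact: le_trans (F_le Kf) f1.
Qed.

Let opn_ub E f : (forall f, K f -> E f <= F f) -> K f -> nrm f <= 1 -> E f <= opn E.
Proof.
move=> EF Kf f1; apply: ub_le_sup; first exact: (opn_has_sup EF).2.
by exists f.
Qed.

Let opn_le E C : (forall f, K f -> E f <= F f) ->
  (forall f, K f -> nrm f <= 1 -> E f <= C) -> opn E <= C.
Proof.
move=> EF EC; apply: ge_sup; first exact: (opn_has_sup EF).1.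
by move=> _ [f [Kf f1] <-]; exact: EC.
Qed.

Let le_sqrt_of_sqr (x y : R) : 0 <= x -> x ^+ 2 <= y -> x <= Num.sqrt y.
Proof. by move=> x0 h; rewrite -[x]ger0_norm// -sqrtr_sqr ler_wsqrtr. Qed.

Let sqr_le_of_le_sqrt (x y : R) : 0 <= x -> 0 <= y -> x <= Num.sqrt y -> x ^+ 2 <= y.
Proof.
by move=> x0 y0 h; rewrite -[y]sqr_sqrtr// lerXn2r ?nnegrE ?sqrtr_ge0.
Qed.

(** Pure order theory, with F, G, H standing for the norms of B f, T f, H f. Since [m_lower] tests
    unit vectors only while [m_upper] holds on the whole ball, suprema over the sphere and over the
    ball are treated alike. *)
Lemma sup_formulas :
  [/\ m = Num.sqrt (1 - opn F ^+ 2),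
      m = Num.sqrt (1 - sup [set G f ^+ 2 + H f ^+ 2 | f in [set f | K f /\ nrm f = 1]]),
      Num.sqrt (Num.max 0 (1 - (opn G ^+ 2 + opn H ^+ 2))) <= m &
      m <= Num.min (Num.sqrt (1 - opn G ^+ 2)) (Num.sqrt (1 - opn H ^+ 2))].
Proof.
have GF f : K f -> G f <= F f.
  by move=> Kf; rewrite -(@ler_pXn2r _ 2) ?nnegrE ?G_ge0// F_sqr// lerDl sqr_ge0.
have HF f : K f -> H f <= F f.
  by move=> Kf; rewrite -(@ler_pXn2r _ 2) ?nnegrE ?H_ge0// F_sqr// lerDr sqr_ge0.
have FF f : K f -> F f <= F f by [].
have F_ub f : K f -> nrm f <= 1 -> F f <= opn F by exact: opn_ub FF.
have G_ub f : K f -> nrm f <= 1 -> G f <= opn G by exact: opn_ub GF.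
have H_ub f : K f -> nrm f <= 1 -> H f <= opn H by exact: opn_ub HF.
have F0 : 0 <= opn F := le_trans (F_ge0 o) (F_ub _ Ko nrm_o).
have G0 : 0 <= opn G := le_trans (G_ge0 Ko) (G_ub _ Ko nrm_o).
have H0 : 0 <= opn H := le_trans (H_ge0 Ko) (H_ub _ Ko nrm_o).
have m1 : m ^+ 2 <= 1.
  by apply: (le_trans (m_upper Ko nrm_o)); rewrite gerBl sqr_ge0.
have Fm : opn F ^+ 2 <= 1 - m ^+ 2.
  apply: sqr_le_of_le_sqrt; rewrite ?subr_ge0//.
  apply: (opn_le FF) => f Kf f1; apply: le_sqrt_of_sqr => //.
  by rewrite lerBrDr addrC -lerBrDr; exact: m_upper.
have mE : m = Num.sqrt (1 - opn F ^+ 2).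
  apply: le_anti; rewrite le_sqrt_of_sqr//=; last by rewrite lerBrDr addrC -lerBrDr.
  by apply: m_lower => // f Kf f1; apply: F_ub; rewrite ?f1.
have Gle : opn G <= opn F.
  by apply: (opn_le GF) => f Kf f1; exact: le_trans (GF f Kf) (F_ub f Kf f1).
have Hle : opn H <= opn F.
  by apply: (opn_le HF) => f Kf f1; exact: le_trans (HF f Kf) (F_ub f Kf f1).
split => //.
- set S := [set _ | _ in _].
  have Sub f : K f -> nrm f = 1 -> F f ^+ 2 <= sup S.
    move=> Kf f1; rewrite F_sqr//; apply: ub_le_sup; last by exists f.
    exists 1 => _ [g [Kg g1] <-]; rewrite -F_sqr// expr_le1//.
    by rewrite -g1; exact: F_le.
  have S0 : 0 <= sup S.
    (* On an empty sphere the supremum is 0 by convention; [m_lower] with constant 0 and [m1] then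
       give m = 1. *)
    have [[_ [f [Kf f1] _]]|] := pselect (S !=set0).
      exact: le_trans (sqr_ge0 _) (Sub f Kf f1).
    by move=> /set0P/negP/negPn/eqP ->; rewrite sup0.
  apply: le_anti; rewrite le_sqrt_of_sqr//=.
    rewrite -[X in 1 - X]sqr_sqrtr//; apply: m_lower; first exact: sqrtr_ge0.
    by move=> f Kf f1; apply: le_sqrt_of_sqr => //; exact: Sub.
  rewrite lerBrDr addrC -lerBrDr; have [SN|] := pselect (S !=set0).
    apply: ge_sup => // _ [f [Kf f1] <-]; rewrite -F_sqr//.
    by rewrite lerBrDr addrC -lerBrDr; apply: m_upper; rewrite ?f1.
  by move=> /set0P/negP/negPn/eqP ->; rewrite sup0 subr_ge0.
- rewrite mE ler_wsqrtr// ge_max; apply/andP; split.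
    by rewrite subr_ge0; apply: (le_trans Fm); rewrite gerBl sqr_ge0.
  rewrite lerD2l lerN2; apply: sqr_le_of_le_sqrt; rewrite ?addr_ge0 ?sqr_ge0//.
  apply: (opn_le FF) => f Kf f1; apply: le_sqrt_of_sqr => //.
  by rewrite F_sqr// lerD// lerXn2r ?nnegrE ?G_ge0 ?H_ge0// ?G_ub ?H_ub.
- by rewrite mE le_min !ler_wsqrtr// lerD2l lerN2 lerXn2r ?nnegrE.
Qed.

End SupremumFormulas.

(** * The minimum modulus for everywhere unimodular symbols *)

Section MinimumModulus.
Context {R : realType}.
Variables b phi : R -> R[i].
Hypotheses (mb : cmeasurable b) (b1 : forall t, Normc.normc (b t) = 1).
Hypotheses (mphi : cmeasurable phi) (phi1 : forall t, Normc.normc (phi t) = 1).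
Hypothesis bH2 : forall h, H2 h -> H2 (b \* h).
Implicit Types (f g h w : R -> R[i]) (z : R[i]).

(** The model space depends on u only through its boundary function, here replaced by an arbitrary
    representative. *)
Definition model_space_of (a : R -> R[i]) : set (R -> R[i]) :=
  [set f | H2 f /\ forall h, H2 h -> inner f (a \* h) = 0].

Notation K := (model_space_of b).

Lemma model_subspace : linear_subspace K.
Proof.
have [HL H0 HD HZ] := @H2_subspace R.
have Lb h : H2 h -> L2 (b \* h) by move=> Hh; exact: HL _ (bH2 Hh).
split=> [f [/HL]//||f g [Hf fb] [Hg gb]|z f [Hf fb]].
- split=> // h /Lb Lh; rewrite /inner; under eq_fun do rewrite mul0r.
  exact: cintegral_cst.
- split=> [|h Hh]; first exact: HD.
  by rewrite innerDl ?fb ?gb ?addr0//; [exact: HL|exact: HL|exact: Lb].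
- split=> [|h Hh]; first exact: HZ.
  by rewrite innerZl ?fb ?mulr0//; [exact: HL|exact: Lb].
Qed.

Let KL f : K f -> L2 f.
Proof. by move=> [[]]. Qed.

(* P_K w = P w - b P (conj b w), where P is the projection onto H^2. *)
Lemma model_proj_formula w : L2 w ->
  is_proj K w (orthoproj H2 w \- (b \* orthoproj H2 (conjf b \* w))).
Proof.
move=> Lw; have [HL _ _ _] := @H2_subspace R.
have Lbw := unimodular_conj_L2 mb b1 Lw.
have [Hp pP] := H2_proj Lw; have [Hq qP] := H2_proj Lbw.
set p := orthoproj H2 w in Hp pP *; set q := orthoproj H2 _ in Hq qP *.
have Lp := HL _ Hp; have Lq := HL _ Hq; have Lbq := HL _ (bH2 Hq).
split; first split.
- by apply: subspaceB => //; [exact: H2_subspace|exact: bH2].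
- move=> h Hh; have Lh := HL _ Hh; have Lbh := HL _ (bH2 Hh).
  (* Both terms of the candidate pair with b h to <w, b h>: the first because b h is in H^2, the
     second because b is unimodular. *)
  have e1 : inner p (b \* h) = inner w (b \* h).
    have := pP _ (bH2 Hh); rewrite innerBl// => /eqP.
    by rewrite subr_eq0 => /eqP.
  have e2 : inner q h = inner (conjf b \* w) h.
    have := qP _ Hh; rewrite innerBl// => /eqP.
    by rewrite subr_eq0 => /eqP.
  rewrite innerBl// e1 inner_mulr -e2 inner_mulr.
  rewrite (_ : conjf b \* (b \* q) = q) ?subrr//.
  by apply/funext => t /=; rewrite /conjf conjE mulrA (mulrC _^*) unimodular_mulcJ ?mul1r.
- move=> h [Hh hb]; have Lh := HL _ Hh.
  rewrite (_ : _ \- _ = (w \- p) \+ (b \* q)); last first.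
    by apply/funext => t /=; rewrite opprB addrA addrAC.
  rewrite innerDl ?pP ?add0r//; last exact: L2B.
  by rewrite (inner_conj Lh Lbq) hb// rmorph0.
Qed.

Lemma model_proj w : L2 w -> is_proj K w (orthoproj K w).
Proof. by move=> Lw; apply: orthoprojP; eexists; exact: model_proj_formula. Qed.

(** The residual is (w - P w) + b P (conj b w), an orthogonal sum because the second term is in
    H^2. *)
Lemma model_residual_norm w : L2 w -> norm2 (w \- orthoproj K w) ^+ 2 =
  norm2 (orthoproj H2 (conjf b \* w)) ^+ 2 + norm2 (w \- orthoproj H2 w) ^+ 2.
Proof.
move=> Lw; have [HL _ _ _] := @H2_subspace R.
have Lbw := unimodular_conj_L2 mb b1 Lw.
have [Hp pP] := H2_proj Lw; have [Hq qP] := H2_proj Lbw.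
rewrite (is_proj_norm_eq model_subspace Lw (model_proj Lw) (model_proj_formula Lw)).
set p := orthoproj H2 w in Hp pP *; set q := orthoproj H2 _ in Hq qP *.
have Lp := HL _ Hp; have Lbq := HL _ (bH2 Hq).
rewrite (_ : _ \- (_ \- _) = (w \- p) \+ (b \* q)); last first.
  by apply/funext => t /=; rewrite opprB addrA addrAC.
rewrite pythagoras ?pP ?norm2_unimodular 1?addrC//; [exact: L2B|exact: bH2].
Qed.

Let B f := (conjf phi \* f) \- orthoproj K (conjf phi \* f).
Let D f := (phi \* f) \- orthoproj K (phi \* f).
Let Tn f := norm2 (orthoproj H2 (conjf (b \* phi) \* f)).
Let Hn f := norm2 ((conjf phi \* f) \- orthoproj H2 (conjf phi \* f)).

Let Lphi f : L2 f -> L2 (phi \* f).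
Proof. exact: unimodular_L2. Qed.
Let Lphic f : L2 f -> L2 (conjf phi \* f).
Proof. exact: unimodular_conj_L2. Qed.

Let B_sqr f : K f -> norm2 (B f) ^+ 2 = Tn f ^+ 2 + Hn f ^+ 2.
Proof.
move=> /KL Lf; rewrite /B model_residual_norm; last exact: Lphic.
have -> // : conjf b \* (conjf phi \* f) = conjf (b \* phi) \* f.
by apply/funext => t /=; rewrite /conjf !conjE rmorphM /=; ring.
Qed.

Let B_le f : K f -> norm2 (B f) <= norm2 f.
Proof.
move=> /KL Lf; rewrite -(norm2_unimodular_conj phi1 f).
rewrite -(@ler_pXn2r _ 2) ?nnegrE ?norm2_ge0//.
by rewrite (is_proj_pythagoras model_subspace (Lphic Lf) (model_proj (Lphic Lf))) lerDl sqr_ge0.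
Qed.

(** Only the norms scale provably: [orthoproj] picks some representative, so B itself need not be
    homogeneous pointwise. *)
Let B_scale z f : K f -> norm2 (B (z \*o f)) = Normc.normc z * norm2 (B f).
Proof.
move=> /KL Lf; have Lw := Lphic Lf; have Lzw := L2Z z Lw.
have pw := model_proj Lw; rewrite -norm2Z; last by apply: L2B => //; exact: KL pw.1.
rewrite /B (_ : conjf phi \* (z \*o f) = z \*o (conjf phi \* f)); last first.
  by apply/funext => t /=; rewrite mulrCA.
rewrite (is_proj_norm_eq model_subspace Lzw (model_proj Lzw) (is_projZ z model_subspace Lw pw)).
by congr norm2; apply/funext => t /=; rewrite mulrBr.
Qed.

Let LB f : K f -> L2 (B f).
Proof.
move=> /KL Lf; apply: L2B; first exact: Lphic.
exact: KL (model_proj (Lphic Lf)).1.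
Qed.

Let B_compl f : K f -> orthocompl K (B f).
Proof. by move=> Kf; split; [exact: LB|exact: (model_proj (Lphic (KL Kf))).2]. Qed.

Let D_sqr f : L2 f ->
  norm2 (D f) ^+ 2 = norm2 f ^+ 2 - norm2 (orthoproj K (phi \* f)) ^+ 2.
Proof.
move=> Lf; rewrite -(norm2_unimodular phi1 f).
by rewrite (is_proj_pythagoras model_subspace (Lphi Lf) (model_proj (Lphi Lf))) addrK.
Qed.

(* On the orthogonal complement of K, the map f |-> P_K (phi f) is the adjoint of B. *)
Let adjoint f g : orthocompl K f -> K g ->
  inner (orthoproj K (phi \* f)) g = inner f (B g).
Proof.
move=> [Lf fK] Kg; have Lg := KL Kg; have [Kp pP] := model_proj (Lphi Lf).
have [Kq qP] := model_proj (Lphic Lg).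
rewrite /B innerBr ?(fK _ Kq) ?subr0//; [|exact: Lphic|exact: KL].
rewrite -inner_mull; have := pP _ Kg; rewrite innerBl//; [|exact: Lphi|exact: KL].
by move/eqP; rewrite subr_eq0 => /eqP.
Qed.

Let m := inf [set norm2 (D f) | f in [set f | orthocompl K f /\ norm2 f = 1]].

(** b = b * 1 lies in b H^2, hence is orthogonal to K. This makes the set defining m nonempty, so
    its infimum is meaningful. *)
Let unit_compl : orthocompl K b /\ norm2 b = 1.
Proof.
have bE : b \* (fun=> 1) = b by apply/funext => t /=; rewrite mulr1.
split; last first.
  rewrite -bE norm2_unimodular//; apply/eqP.
  rewrite -(@eqrXn2 _ 2) ?norm2_ge0 ?ler01// expr1n norm2_sqr /inner.
  by under eq_fun do rewrite conjC1 mulr1; rewrite cintegral_cst.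
have Lb : L2 b by rewrite -bE; apply: unimodular_L2 => //; exact: L2_cst.
split=> // g [[Lg _] gb].
by rewrite (inner_conj Lg Lb) -[X in inner g X]bE gb ?rmorph0//; exact: H2_one.
Qed.

Let m_has_inf : has_inf [set norm2 (D f) | f in [set f | orthocompl K f /\ norm2 f = 1]].
Proof.
split; first by exists (norm2 (D b)), b.
by exists 0 => _ [f _ <-]; exact: norm2_ge0.
Qed.

Let m_ge0 : 0 <= m.
Proof. by apply: lb_le_inf => [|_ [f _ <-]]; [exact: m_has_inf.1|exact: norm2_ge0]. Qed.

Let m_le f : orthocompl K f -> norm2 f = 1 -> m <= norm2 (D f).
Proof. by move=> Kf f1; apply: (ge_inf m_has_inf.2); exists f. Qed.

(** With p = P_K (phi f) and |f| = 1, the adjoint relation gives |p|^2 = <f, B p> <= C |p|, so |p|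
    <= C. *)
Let m_lower (C : R) : 0 <= C -> (forall p, K p -> norm2 (B p) <= C * norm2 p) ->
  Num.sqrt (1 - C ^+ 2) <= m.
Proof.
move=> C0 BC; apply: lb_le_inf => [|_ [f [Kf f1] <-]]; first exact: m_has_inf.1.
have Lf := Kf.1; have [Kp pP] := model_proj (Lphi Lf).
set p := orthoproj K (phi \* f) in Kp pP.
have : norm2 p ^+ 2 <= C * norm2 p.
  rewrite norm2_sqr adjoint//; apply: (le_trans (Re_inner_le Lf (LB Kp))).
  by rewrite f1 mul1r BC.
have p0 := norm2_ge0 p => pC.
have {}pC : norm2 p <= C.
  have [->//|pn] := eqVneq (norm2 p) 0.
  by move: pC; rewrite expr2 ler_pM2r// lt_neqAle eq_sym pn.
rewrite -[leRHS]ger0_norm ?norm2_ge0// -sqrtr_sqr ler_wsqrtr// D_sqr// f1 expr1n.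
by rewrite lerD2l lerN2 lerXn2r ?nnegrE.
Qed.

(* Tested on the normalisation of B g, which lies in the orthogonal complement of K. *)
Let m_upper g : K g -> norm2 g <= 1 -> m ^+ 2 <= 1 - norm2 (B g) ^+ 2.
Proof.
move=> Kg g1; have n0 := norm2_ge0 (B g).
have mD f : orthocompl K f -> norm2 f = 1 ->
    m ^+ 2 <= 1 - norm2 (orthoproj K (phi \* f)) ^+ 2.
  move=> Kf f1; rewrite -[X in X - _](expr1n _ 2) -f1 -D_sqr; last exact: Kf.1.
  by rewrite lerXn2r ?nnegrE ?norm2_ge0 ?m_le.
(* B g cannot be normalised if its norm is 0; any unit vector then gives the claim m <= 1, and b is
   one. *)
have [B0|Bn] := eqVneq (norm2 (B g)) 0.
  rewrite B0 expr0n subr0; have [Kb nb] := unit_compl.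
  by apply: (le_trans (mD _ Kb nb)); rewrite gerBl sqr_ge0.
have B0 : 0 < norm2 (B g) by rewrite lt_neqAle eq_sym Bn.
have LBg := LB Kg; have [_ BK] := B_compl Kg.
pose z : R[i] := (norm2 (B g))^-1%:C; pose f := z \*o B g.
have Lf : L2 f by exact: L2Z.
have Kf : orthocompl K f.
  by split=> // h Kh; rewrite innerZl ?BK ?mulr0//; exact: KL.
have f1 : norm2 f = 1.
  by rewrite norm2Z// normc_real ger0_norm ?invr_ge0// mulVf.
apply: (le_trans (mD _ Kf f1)); rewrite lerD2l lerN2 lerXn2r ?nnegrE ?norm2_ge0//.
have [Kp _] := model_proj (Lphi Lf).
(* By adjointness |B g| = <f, B g> = <P_K (phi f), g>, which is at most |P_K (phi f)| since |g| <=
   1. *)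
have := Re_inner_le (KL Kp) (KL Kg); rewrite adjoint// innerZl// innerff.
rewrite -rmorphM /= expr2 mulrA mulVf// mul1r => /le_trans; apply.
by rewrite ler_piMr ?norm2_ge0.
Qed.

Let scaled_bound (C : R) : 0 <= C ->
  (forall f, K f -> norm2 f = 1 -> norm2 (B f) <= C) ->
  forall p, K p -> norm2 (B p) <= C * norm2 p.
Proof.
move=> C0 BC p Kp; have [p0|pn] := eqVneq (norm2 p) 0.
  (* A vector of norm 0 need not be the zero function, so contractivity of B is used instead. *)
  by rewrite p0 mulr0 -p0 B_le.
have p0 : 0 < norm2 p by rewrite lt_neqAle eq_sym pn norm2_ge0.
pose z : R[i] := (norm2 p)^-1%:C.
have [_ _ _ KZ] := model_subspace.
have nz : Normc.normc z = (norm2 p)^-1 by rewrite normc_real ger0_norm// invr_ge0 ltW.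
have := BC (z \*o p) (KZ _ _ Kp); rewrite norm2Z ?B_scale ?nz ?mulVf//; last exact: KL.
by move=> /(_ erefl); rewrite mulrC ler_pdivrMr.
Qed.

Lemma min_modulus_formulas :
  let beta := sup [set norm2 (B f) | f in [set f | K f /\ norm2 f <= 1]] in
  let tau := sup [set Tn f | f in [set f | K f /\ norm2 f <= 1]] in
  let eta := sup [set Hn f | f in [set f | K f /\ norm2 f <= 1]] in
  [/\ m = Num.sqrt (1 - beta ^+ 2),
      m = Num.sqrt (1 - sup [set Tn f ^+ 2 + Hn f ^+ 2 |
                             f in [set f | K f /\ norm2 f = 1]]),
      Num.sqrt (Num.max 0 (1 - (tau ^+ 2 + eta ^+ 2))) <= m &
      m <= Num.min (Num.sqrt (1 - tau ^+ 2)) (Num.sqrt (1 - eta ^+ 2))].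
Proof.
have [_ K0 _ _] := model_subspace.
apply: (sup_formulas K0) => //.
- rewrite /norm2; under eq_Rintegral do rewrite (normc_real 0) normr0 expr0n.
  by rewrite Rintegral_cst// mul0r sqrtr0 ler01.
- by move=> f; exact: norm2_ge0.
- by move=> f _; exact: norm2_ge0.
- by move=> f _; exact: norm2_ge0.
- by move=> C C0 /(scaled_bound C0); exact: m_lower.
Qed.

End MinimumModulus.

(** * Boundary values of inner functions *)

Section Boundary.
Context {R : realType}.
Notation mu := (circle_prob R).
Implicit Types (f g h : R -> R[i]) (u : R[i] -> R[i]).

(** Setting the value to 1 wherever the modulus differs from 1 keeps measurability, and later
    products by this function need no exceptional set. *)
Lemma unimodular_version f : cmeasurable f ->
  exists g, [/\ cmeasurable g, forall t, Normc.normc (g t) = 1 &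
    forall t, Normc.normc (f t) = 1 -> g t = f t].
Proof.
move=> mf; pose g t := if Normc.normc (f t) == 1 then f t else 1.
have mE : measurable_fun [set: R] (fun t => Normc.normc (f t) == 1).
  by apply: measurable_fun_eqr; [exact: measurable_normc|exact: measurable_cst].
exists g; split.
- have [m1 m2] := mf; split.
    rewrite (_ : (fun t => _) =
      (fun t => if Normc.normc (f t) == 1 then complex.Re (f t) else 1)).
      by apply: measurable_fun_ifT => //; exact: measurable_cst.
    by apply/funext => t; rewrite /g; case: ifP.
  rewrite (_ : (fun t => _) =
    (fun t => if Normc.normc (f t) == 1 then complex.Im (f t) else 0)).
    by apply: measurable_fun_ifT => //; exact: measurable_cst.
  by apply/funext => t; rewrite /g; case: ifP.
- by move=> t; rewrite /g; case: ifPn => [/eqP//|_]; exact: Normc.normc1.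
- by move=> t ft; rewrite /g ft eqxx.
Qed.

Lemma unimodular_ae f : unimodular f -> {ae mu, forall t, Normc.normc (f t) = 1}.
Proof. by apply: ae_mono => t; rewrite normc_norm => /(@complexI R). Qed.

(* Radii [expR s] with [s] increasing to 0, matching the logarithmic
   coordinate of [circle_mul_coef0]. *)
Let s_ (n : nat) : R := - n.+1%:R^-1.

Let s_lt0 n : s_ n < 0.
Proof. by rewrite oppr_lt0 invr_gt0. Qed.

Let expR_s_cvg : expR (s_ n) @[n --> \oo] --> (1 : R)^'-.
Proof.
have sc : s_ @ \oo --> 0.
  by rewrite -oppr0; apply: cvgN; exact: cvg_harmonic.
have ec : expR (s_ n) @[n --> \oo] --> (1 : R).
  by rewrite -expR0; exact: (cvg_comp _ _ sc (@continuous_expR R 0)).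
move=> A hA; have [N _ hN] := ec _ hA; exists N => // n Nn.
by apply: (hN n Nn); rewrite /= expR_lt1.
Qed.

Let radial_seq u t : cvg (radial u t r @[r --> (1 : R)^'-]) ->
  Normc.normc (u (cexp (s_ n +i* t)) - boundary u t) @[n --> \oo] --> 0.
Proof.
move=> /(cvg_comp _ _ expR_s_cvg) cu; apply/cvgr0Pnorm_lt => e e0.
have e1 : (0 : R[i]) < e%:C by rewrite ltcR.
have /cvgrPdist_lt/(_ _ e1) := cu; apply: filterS => n /=.
rewrite /radial distrC normc_norm ltcR ger0_norm ?normc_ge0//.
Qed.

Lemma boundary_version u : inner_function u -> exists b : R -> R[i],
  [/\ cmeasurable b, forall t, Normc.normc (b t) = 1,
      {ae mu, forall t, boundary u t = b t} &
      forall h, H2 h -> H2 (b \* h)].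
Proof.
move=> [au [M uM] ucvg u1].
pose b_ n t := u (cexp (s_ n +i* t)).
have mb_ n : cmeasurable (b_ n) by exact: circle_measurable.
have bM n t : Normc.normc (b_ n t) <= M by exact: circle_bounded.
have ubcvg : {ae mu, forall t, Normc.normc (b_ n t - boundary u t) @[n --> \oo] --> 0}.
  by apply: ae_mono ucvg => t; exact: radial_seq.
have part (p : R[i] -> R) : (forall z w, p (z - w) = p z - p w) ->
    (forall z, `|p z| <= Normc.normc z) ->
    (forall n, measurable_fun [set: R] (fun t => p (b_ n t))) ->
    exists2 q : R -> R, measurable_fun [set: R] q &
      {ae mu, forall t, q t = p (boundary u t)}.
  (* As a total [lim], [boundary u] comes with no measurability; the upper limit along the radii
     exp(s_n) is measurable and agrees with it almost everywhere. *)
  move=> pB pN mp; exists (fun t => fine (limn_esup (fun n => (p (b_ n t))%:E))).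
    apply: (@measurableT_comp _ _ _ _ _ _ fine); first exact: fine_measurable.
    by apply: measurable_fun_limn_esup => n; exact/measurable_EFinP.
  apply: ae_mono ubcvg => t ut.
  have pc : p (b_ n t) @[n --> \oo] --> p (boundary u t).
    apply/subr_cvg0/norm_cvg0P.
    apply: (@squeeze_cvgr _ _ _ _ (fun=> 0) (fun n => Normc.normc (b_ n t - boundary u t))) => //.
      by apply: nearW => n; rewrite normr_ge0 /= -pB.
    exact: cvg_cst.
  by have [_ ->] := cvg_limn_einf_sup (cvgn_EFin pc).
have [q1 mq1 q1E] := part _ cReB norm_Re_le (fun n => (mb_ n).1).
have [q2 mq2 q2E] := part _ cImB norm_Im_le (fun n => (mb_ n).2).
have [b [mb b1 bE]] := @unimodular_version (fun t => q1 t +i* q2 t) (conj mq1 mq2).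
have ub : {ae mu, forall t, boundary u t = b t}.
  have qE : {ae mu, forall t, boundary u t = q1 t +i* q2 t}.
    by apply: ae_mono2 q1E q2E => t e1 e2; apply: complex_ext.
  by apply: ae_mono2 qE (unimodular_ae u1) => t e1 e2; rewrite bE -e1.
exists b; split => // h [Lh h0]; split; first exact: unimodular_L2.
move=> n n0; have mh := L2_measurable Lh.
rewrite /fourier; under eq_fun do rewrite -expiN -mulNr -mulrNz /=.
have nn0 : 0 < - n by rewrite oppr_gt0.
apply: (@cintegral_dominated0 _ (fun k t => b_ k t * h t * expi ((- n)%:~R * t)) _
  (fun t => M * Normc.normc (h t))).
- move=> k; apply: cmeasurableM; last exact: expi_measurable.
  exact: cmeasurableM.
- by apply: cmeasurableM; [exact: cmeasurableM|exact: expi_measurable].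
- by apply: rintegrableZ; apply: cintegrable_normc; exact: L2_cintegrable.
- move=> k t; rewrite !Normc.normcM normc_expi mulr1.
  by rewrite ler_wpM2r ?normc_ge0.
- apply: ae_mono2 ub ubcvg => t <- ut.
  have -> : (fun k => Normc.normc (b_ k t * h t * expi ((- n)%:~R * t) -
      boundary u t * h t * expi ((- n)%:~R * t))) =
      (fun k => Normc.normc (b_ k t - boundary u t) * Normc.normc (h t)).
    by apply/funext => k; rewrite -!mulrBl !Normc.normcM normc_expi mulr1.
  by rewrite -[X in _ --> X](mul0r (Normc.normc (h t))); exact: cvgMl.
- by move=> k; apply: circle_mul_coef0 au uM (s_lt0 k) _ _ Lh h0 nn0.
Qed.

Lemma eq_min_modulus (M : set (R -> R[i])) (S T : (R -> R[i]) -> R -> R[i]) :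
  (forall f, norm2 (S f) = norm2 (T f)) -> min_modulus M S = min_modulus M T.
Proof. by move=> ST; congr inf; apply: eq_imagel => f _; exact: ST. Qed.

Lemma eq_opnorm (M : set (R -> R[i])) (S T : (R -> R[i]) -> R -> R[i]) :
  (forall f, norm2 (S f) = norm2 (T f)) -> opnorm M S = opnorm M T.
Proof. by move=> ST; congr sup; apply: eq_imagel => f _; exact: ST. Qed.

End Boundary.


Local Open Scope complex_scope.

Theorem theorem5p5 (R : realType) (u : R[i] -> R[i]) (phi : R -> R[i])
    (hu : inner_function u) (hnc : nonconstant_disc u)
    (hphi : Linfty phi) (hphi1 : unimodular phi) :
  let K := model_space u in
  let T := toeplitz (conjf (boundary u \* phi)) in
  let H := hankel (conjf phi) in
  let m := min_modulus (orthocompl K) (dualTTO u phi) in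
  [/\ m = Num.sqrt (1 - opnorm K (Bop u (conjf phi)) ^+ 2),
      m = Num.sqrt (1 - sup [set norm2 (T f) ^+ 2 + norm2 (H f) ^+ 2 |
                             f in [set f | K f /\ norm2 f = 1]]),
      Num.sqrt (Num.max 0 (1 - (opnorm K T ^+ 2 + opnorm K H ^+ 2))) <= m &
      m <= Num.min (Num.sqrt (1 - opnorm K T ^+ 2))
                   (Num.sqrt (1 - opnorm K H ^+ 2))].
Proof.
move=> K T H m.
have [b [mb b1 ub bH2]] := boundary_version hu.
have [a [ma a1 aE]] := unimodular_version hphi.1.
have pa : {ae circle_prob R, forall t, phi t = a t}.
  by apply: ae_mono (unimodular_ae hphi1) => t /aE.
(* An equality of sets: the condition involving [boundary u] only tests inner products, which do not
   see null sets. *)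
have KE : K = model_space_of b.
  apply/seteqP; split=> f [Hf fK]; split=> // h Hh; rewrite -(fK h Hh);
    by apply: ae_eq_inner; [exact: aeW|apply: ae_mono ub => t /= ->].
have mulE f : {ae circle_prob R, forall t, (phi \* f) t = (a \* f) t}.
  by apply: ae_mono pa => t /= ->.
have mulcE f : {ae circle_prob R, forall t, (conjf phi \* f) t = (conjf a \* f) t}.
  by apply: ae_mono pa => t /=; rewrite /conjf => ->.
have mulbE f : {ae circle_prob R, forall t,
    (conjf (boundary u \* phi) \* f) t = (conjf (b \* a) \* f) t}.
  by apply: ae_mono2 ub pa => t /=; rewrite /conjf /= => -> ->.
have residual M f1 f2 : {ae circle_prob R, forall t, f1 t = f2 t} ->
    norm2 (f1 \- orthoproj M f1) = norm2 (f2 \- orthoproj M f2).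
  move=> f12; rewrite (ae_eq_orthoproj M f12).
  by apply: ae_eq_norm2; apply: ae_mono f12 => t /= ->.
have TE f : norm2 (T f) = norm2 (orthoproj H2 (conjf (b \* a) \* f)).
  by rewrite /T /toeplitz (ae_eq_orthoproj _ (mulbE f)).
have HE f : norm2 (H f) = norm2 ((conjf a \* f) \- orthoproj H2 (conjf a \* f)).
  exact: (residual _ _ _ (mulcE f)).
have DE f : norm2 (dualTTO u phi f) = norm2 ((a \* f) \- orthoproj K (a \* f)).
  exact: (residual K _ _ (mulE f)).
have BE f : norm2 (Bop u (conjf phi) f) =
    norm2 ((conjf a \* f) \- orthoproj K (conjf a \* f)).
  exact: (residual K _ _ (mulcE f)).
have mE : m = inf [set norm2 ((a \* f) \- orthoproj (model_space_of b) (a \* f)) |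
    f in [set f | orthocompl (model_space_of b) f /\ norm2 f = 1]].
  rewrite -KE.
  exact: (@eq_min_modulus _ _ (dualTTO u phi) (fun f => (a \* f) \- orthoproj K (a \* f)) DE).
have opB : opnorm K (Bop u (conjf phi)) =
    sup [set norm2 ((conjf a \* f) \- orthoproj (model_space_of b) (conjf a \* f)) |
    f in [set f | model_space_of b f /\ norm2 f <= 1]].
  by rewrite -KE; exact: (@eq_opnorm _ _ (Bop u (conjf phi))
    (fun f => (conjf a \* f) \- orthoproj K (conjf a \* f)) BE).
have opT : opnorm K T = sup [set norm2 (orthoproj H2 (conjf (b \* a) \* f)) |
    f in [set f | model_space_of b f /\ norm2 f <= 1]].
  by rewrite -KE; exact: (@eq_opnorm _ _ T
    (fun f => orthoproj H2 (conjf (b \* a) \* f)) TE).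
have opH : opnorm K H = sup [set norm2 ((conjf a \* f) \- orthoproj H2 (conjf a \* f)) |
    f in [set f | model_space_of b f /\ norm2 f <= 1]].
  by rewrite -KE; exact: (@eq_opnorm _ _ H
    (fun f => (conjf a \* f) \- orthoproj H2 (conjf a \* f)) HE).
have SE : [set norm2 (T f) ^+ 2 + norm2 (H f) ^+ 2 | f in [set f | K f /\ norm2 f = 1]] =
    [set norm2 (orthoproj H2 (conjf (b \* a) \* f)) ^+ 2 +
         norm2 ((conjf a \* f) \- orthoproj H2 (conjf a \* f)) ^+ 2 |
     f in [set f | model_space_of b f /\ norm2 f = 1]].
  by rewrite -KE; apply: eq_imagel => f _; rewrite TE HE.
rewrite mE opB SE opT opH; exact: min_modulus_formulas.
Qed.
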